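(* Let $\sigma\in(0,1)$ be the Nash exponent. Let $u^N(t,\frac xN)$ be the solution of $$\partial_tu=L^N_{a(t)}u+g(t,\tfrac xN)\quad\text{on }\tfrac1N\mathbb T_N^n,$$ with $a(t)\in\mathcal A(c_-,c_+)$ continuous in $t$ and $g$ bounded and continuous in $t$, and assume that the initial values satisfy $$\sup_N\max_{x\in\mathbb T_N^n,\,|e_1|=|e_2|=1}|\nabla^N_{e_1}\nabla^N_{e_2}u^N(0,\tfrac xN)|\le C_0<\infty.$$ Then $$|u^N(t_1,\tfrac{x_1}N)-u^N(t_2,\tfrac{x_2}N)|\le C\big(\|g\|_\infty+\|u^N(0)\|_\infty+C_0\big)\Big\{|t_2-t_1|^{\frac\sigma2}+|\tfrac{x_1}N-\tfrac{x_2}N|^\sigma\Big\}$$ for $0\le t_1,t_2\le T$ and $x_1,x_2\in\mathbb T^n_N$, where $C=C(n,c_\pm,T)$ (independent of $N$).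
   Context: Notation. $N\in\mathbb N$, $T>0$, $\mathbb T_N^n=(\mathbb Z/N\mathbb Z)^n$; functions on $\frac1N\mathbb T^n_N\subset\mathbb T^n=\mathbb R^n/\mathbb Z^n$ are written $u(\frac xN)$. For $e\in\mathbb Z^n$, $|e|=1$, $\nabla^N_eu(\frac xN)=N(u(\frac{x+e}N)-u(\frac xN))$. $|\frac{x_1}N-\frac{x_2}N|$ is the Euclidean distance on the torus. $\|g\|_\infty$ is the supremum over $[0,T]\times\frac1N\mathbb T_N^n$. For $0<c_-<c_+<\infty$, $\mathcal A(c_-,c_+)$ is the set of $a=\{a_{x,e}\}_{x\in\mathbb T_N^n,\,|e|=1}$ with $a_{x,e}=a_{x+e,-e}$ and $c_-\le a_{x,e}\le c_+$. $L^N_au(\frac xN)=N^2\sum_{|e|=1}a_{x,e}\{u(\frac{x+e}N)-u(\frac xN)\}$. Nash exponent. $\sigma\in(0,1)$ denotes a fixed exponent for which there is $C=C(n,c_\pm)$ such that for every $N$, every $a(t)=\{a_{x,e}(t)\}_{x\in\mathbb Z^n,|e|=1}$ continuous in $t$ with $a_{x,e}=a_{x+e,-e}$ and $c_-\le a_{x,e}\le c_+$, and every bounded $u_0$ on $\frac1N\mathbb Z^n$, the bounded solution of $\partial_tu(t,\frac xN)=N^2\sum_{|e|=1}a_{x,e}(t)\{u(t,\frac{x+e}N)-u(t,\frac xN)\}$ on $\frac1N\mathbb Z^n$ with $u(0)=u_0$ satisfies $|u(t,\frac xN)-u(s,\frac yN)|\le C\|u_0\|_\infty\big(\frac{|t-s|^{1/2}\vee|\frac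 xN-\frac yN|}{(t\wedge s)^{1/2}}\big)^\sigma$ for all $t,s>0$, $x,y\in\mathbb Z^n$. Such an exponent exists by the Nash continuity estimate. *)

(* Defs.v *)
From HB Require Import structures.
From mathcomp Require Import all_boot all_order all_algebra.
From mathcomp Require Import all_classical all_reals all_analysis.

Set Implicit Arguments.
Unset Strict Implicit.
Unset Printing Implicit Defensive.

Import Order.TTheory GRing.Theory Num.Theory.
Import numFieldNormedType.Exports.

Local Open Scope classical_set_scope.
Local Open Scope ring_scope.

(* (Z/NZ)^n for N > 0. The type 'Z_N is not used because 'Z_1 is Z/2Z, whereas
   'I_m.+1 is the additive group Z/(m+1)Z for every m, including m = 0. *)
Definition torus (n N : nat) : zmodType := 'rV['I_N.-1.+1]_n.

(* A direction (i, b) encodes the unit vector e_i (b = false) or -e_i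
   (b = true) of Z^n; see [unit_vecP] below. *)
Definition dir (n : nat) : finType := ('I_n * bool)%type.

Definition unit_vec (n : nat) (e : dir n) : 'rV[int]_n :=
  (-1) ^+ e.2 *: delta_mx 0 e.1.

Definition dir_opp (n : nat) (e : dir n) : dir n := (e.1, ~~ e.2).

Lemma unit_vec_opp n (e : dir n) : unit_vec (dir_opp e) = - unit_vec e.
Proof.
case: e => i []; rewrite /unit_vec /= ?expr0 ?expr1 ?scaleN1r ?scale1r //.
by rewrite opprK.
Qed.

Lemma unit_vec_inj n : injective (@unit_vec n).
Proof.
move=> [i b] [j c] /matrixP /(_ 0 i); rewrite !mxE /= !eqxx mulr1.
by case: (eqVneq i j) => [<-|_]; case: b; case: c.
Qed.

Lemma unit_vecP n (v : 'rV[int]_n) :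
  \sum_i v 0 i ^+ 2 = 1 <-> exists e : dir n, v = unit_vec e.
Proof.
split=> [v1|[[i b] ->]]; last first.
  rewrite (bigD1 i) //= big1 => [|j /negPf ji].
    by rewrite !mxE !eqxx mulr1 sqrr_sign addr0.
  by rewrite !mxE ji andbF mulr0 expr0n.
have [i vi] : exists i, v 0 i != 0.
  apply/existsP; apply: contraPT v1 => /existsPn v0.
  by rewrite big1 // => i _; have /negPn/eqP -> := v0 i; rewrite expr0n.
move: v1; rewrite (bigD1 i) //=; set s := \sum_(_ | _) _ => v1.
have s0 : 0 <= s by apply: sumr_ge0 => j _; exact: sqr_ge0.
have sq1 (k : int) : k != 0 -> 1 <= k ^+ 2.
  by move=> k0; rewrite -gtz0_ge1 exprn_even_gt0.
have vi1 : v 0 i ^+ 2 = 1.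
  by apply/eqP; rewrite eq_le (sq1 _ vi) andbT -v1 lerDl.
have s00 : s = 0 by apply: (addrI (v 0 i ^+ 2)); rewrite v1 vi1 addr0.
have vj j : j != i -> v 0 j = 0.
  move=> ji; have /psumr_eq0P /(_ j ji) : s = 0 by [].
  by move=> h; apply/eqP; rewrite -sqrf_eq0 h // => k _; exact: sqr_ge0.
exists (i, v 0 i < 0); apply/rowP => j; rewrite !mxE /=.
case: (eqVneq j i) => [->|/vj ->]; last by rewrite mulr0.
rewrite mulr1; move/eqP: vi1; rewrite sqrf_eq1.
by case/orP => /eqP ->.
Qed.

(* The canonical homomorphism Z^n -> (Z/NZ)^n applied to a unit vector. *)
Definition torus_step (n N : nat) (e : dir n) : torus n N :=
  map_mx (fun k : int => (inZp 1 : 'I_N.-1.+1) *~ k) (unit_vec e).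

(* The objects below are common to V = Z^n (with [step := @unit_vec n]) and
   V = (Z/NZ)^n (with [step := @torus_step n N]); a function u on (1/N) V is
   represented by the function x |-> u (x / N) on V. *)
Section Lattice.
Context {R : realType} {n : nat} {V : zmodType} (step : dir n -> V).

Definition grad (N : nat) (e : dir n) (u : V -> R) (x : V) : R :=
  N%:R * (u (x + step e) - u x).

Definition gen (N : nat) (a : V -> dir n -> R) (u : V -> R) (x : V) : R :=
  N%:R ^+ 2 * \sum_(e : dir n) a x e * (u (x + step e) - u x).

Definition elliptic (cm cp : R) (a : V -> dir n -> R) : Prop :=
  (forall x e, a x e = a (x + step e) (dir_opp e)) /\
  (forall x e, cm <= a x e <= cp).

(* u solves d_t u = L_a(t) u + g on the time interval J: u is continuous on J
   and satisfies the equation in the interior of J. When a and g are continuous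
   on J the equation then holds at the endpoints with one-sided derivatives. *)
Definition is_solution (N : nat) (J : set R) (a : R -> V -> dir n -> R)
    (g u : R -> V -> R) : Prop :=
  (forall x, {within J, continuous (fun t => u t x)}) /\
  (forall t x, J° t ->
    is_derive t (1 : R) (fun s => u s x) (gen N (a t) (u t) x + g t x)).

End Lattice.

Definition sup_norm {R : realType} {S : Type} (D : set S) (f : S -> R) : R :=
  sup [set `|f z| | z in D].

Definition enorm {R : realType} {n : nat} (v : 'rV[R]_n) : R :=
  Num.sqrt (\sum_i v 0 i ^+ 2).

Definition lattice_dist (R : realType) (n N : nat) (x y : 'rV[int]_n) : R :=
  enorm (map_mx (fun k : int => k%:~R / N%:R : R) (x - y)).

(* The distance of x / N and y / N in R^n / Z^n. *)
Definition torus_dist (R : realType) (n N : nat) (x y : torus n N) : R :=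
  let pos (z : torus n N) : 'rV[R]_n :=
    map_mx (fun k : 'I_N.-1.+1 => (k : nat)%:R / N%:R) z in
  inf [set enorm (pos x - pos y + map_mx intr k) | k in [set: 'rV[int]_n]].

Definition nash_exponent (R : realType) (n : nat) (cm cp sigma : R) : Prop :=
  0 < sigma < 1 /\
  exists C : R, forall (N : nat) (a : R -> 'rV[int]_n -> dir n -> R)
      (u0 : 'rV[int]_n -> R) (u : R -> 'rV[int]_n -> R),
    (0 < N)%N ->
    (forall x e, {within `[0, +oo[, continuous (fun t => a t x e)}) ->
    (forall t, 0 <= t -> elliptic (@unit_vec n) cm cp (a t)) ->
    [bounded u0 x | x in [set: 'rV[int]_n]] ->
    is_solution (@unit_vec n) N `[0, +oo[ a (fun _ _ => 0) u ->
    [bounded u z.1 z.2 | z in `[0, +oo[ `*` [set: 'rV[int]_n]] ->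
    u 0 = u0 ->
    forall (t s : R) (x y : 'rV[int]_n), 0 < t -> 0 < s ->
      `|u t x - u s y| <=
        C * sup_norm setT u0 *
        (Num.max (Num.sqrt `|t - s|) (lattice_dist R N x y)
           / Num.sqrt (Num.min t s)) `^ sigma.

(* Main.v *)
Require Import Defs.
From HB Require Import structures.
From mathcomp Require Import all_boot all_order all_algebra.
From mathcomp Require Import all_classical all_reals all_analysis.
From mathcomp Require Import ring lra.

Set Implicit Arguments.
Unset Strict Implicit.
Unset Printing Implicit Defensive.

Import Order.TTheory GRing.Theory Num.Theory.
Import numFieldNormedType.Exports.

Local Open Scope classical_set_scope.
Local Open Scope ring_scope.

(* Proof idea. On [0, T] alone the Nash estimate degenerates at time 0, so the
   equation is continued to earlier times: shift time by 1, keep u(0) frozen on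
   [0, 1], and take there the constant coefficient cm, with right-hand side
   - cm Delta u(0), which the bound on second differences controls by C0. The
   Nash estimate needs coefficients that are continuous in time, so cm and a(0)
   are interpolated on [1 - delta, 1]; the right-hand side is there only bounded
   by a constant depending on N, but its contribution is O(delta), and delta
   tends to 0 for fixed N. Let S(s, t) be the propagator of the homogeneous
   equation. By Duhamel's formula, the derivative in s of S(s, t) applied to the
   extended solution is S(s, t) applied to the right-hand side, and the Nash
   estimate, applied to the periodic lifts to Z^n, bounds the difference of its
   values at two space-time points by an integrable power of t - s. *)

(** * Differentiation along the line *)

Section Calculus.
Context {R : realType}.
Implicit Types (f g F G : R -> R) (a b t : R).

Lemma is_derive_bigsum (I : finType) (f : I -> R -> R) (df : I -> R) t :
  (forall i, is_derive t 1 (f i) (df i)) ->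
  is_derive t 1 (fun s => \sum_i f i s) (\sum_i df i).
Proof.
move=> fD; rewrite (_ : (fun s => _) = \sum_i f i); last first.
  by apply/funext => s; rewrite fct_sumE.
by elim/big_ind2 : _ => // [|] *; [exact: is_derive_cst|exact: is_deriveD].
Qed.

Lemma is_derive_mul f g t df dg :
  is_derive t 1 f df -> is_derive t 1 g dg ->
  is_derive t 1 (fun s => f s * g s) (df * g t + f t * dg).
Proof.
move=> fD gD; apply: is_derive_eq.
by rewrite addrC [g t *: _]mulrC.
Qed.

Lemma is_derive_sub f g t df dg :
  is_derive t 1 f df -> is_derive t 1 g dg ->
  is_derive t 1 (fun s => f s - g s) (df - dg).
Proof. by move=> fD gD; apply: is_deriveB. Qed.

Lemma is_derive_translate f t (k df : R) :
  is_derive (t + k) 1 f df -> is_derive t 1 (fun s => f (s + k)) df.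
Proof.
move=> fD; have kD : is_derive t (1 : R) (fun s : R => s + k) 1.
  by apply: is_derive_eq; rewrite addr0.
by have := @is_derive1_comp R f (fun s => s + k) t _ _ fD kD; rewrite mulr1.
Qed.

Lemma near_is_derive f g t df :
  {near t, f =1 g} -> is_derive t 1 f df -> is_derive t 1 g df.
Proof.
move=> fg [fD <-]; apply: DeriveDef; first exact: near_eq_derivable fD.
by apply/esym/near_eq_derive.
Qed.

Lemma continuous_bigsum (I : finType) (T : topologicalType) (f : I -> T -> R) :
  (forall i, continuous (f i)) -> continuous (fun x => \sum_i f i x).
Proof.
move=> fC x; rewrite (_ : (fun s => _) = \sum_i f i); last first.
  by apply/funext => s; rewrite fct_sumE.
elim/big_ind : _ => [|g h gC hC|i _]; [exact: cst_continuous| |exact: fC].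
exact: (@continuousD _ _ _ g h x gC hC).
Qed.

Lemma continuous_mul (T : topologicalType) (f g : T -> R) :
  continuous f -> continuous g -> continuous (fun x => f x * g x).
Proof. by move=> fC gC x; apply: cvgM; [exact: fC|exact: gC]. Qed.

Lemma continuous_sub (T : topologicalType) (f g : T -> R) :
  continuous f -> continuous g -> continuous (fun x => f x - g x).
Proof. by move=> fC gC x; apply: cvgB; [exact: fC|exact: gC]. Qed.

Lemma continuous_add (T : topologicalType) (f g : T -> R) :
  continuous f -> continuous g -> continuous (fun x => f x + g x).
Proof. by move=> fC gC x; apply: cvgD; [exact: fC|exact: gC]. Qed.

Lemma continuous_comp_fun (f g : R -> R) :
  continuous f -> continuous g -> continuous (fun x => f (g x)).
Proof. by move=> fC gC x; apply: continuous_comp; [exact: gC|exact: fC]. Qed.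

Lemma maxl_continuous (c : R) : continuous (fun x : R => Num.max c x).
Proof. by move=> x; apply: continuous_max; [exact: cvg_cst|exact: cvg_id]. Qed.

Lemma minl_continuous (c : R) : continuous (fun x : R => Num.min c x).
Proof. by move=> x; apply: continuous_min; [exact: cvg_cst|exact: cvg_id]. Qed.

Lemma ge0_derive_le f (df : R -> R) a b : a <= b -> continuous f ->
  (forall x, a < x < b -> is_derive x 1 f (df x)) ->
  (forall x, a < x < b -> 0 <= df x) -> f a <= f b.
Proof.
move=> ab fC fD df0; apply: (@ger0_derive1_le_cc R f a b) => //.
- by move=> x; rewrite in_itv /= => /fD[].
- move=> x; rewrite in_itv /= => xab; rewrite derive1E.
  by have [_ ->] := fD _ xab; exact: df0.
- exact: continuous_subspaceT.
- by rewrite in_itv /= lexx.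
- by rewrite in_itv /= ab lexx.
Qed.

(* Replaces the integral estimate [|\int f'| <= \int |f'|] throughout. *)
Lemma derive_bound f g (df dg : R -> R) a b : a <= b ->
  continuous f -> continuous g ->
  (forall x, a < x < b -> is_derive x 1 f (df x)) ->
  (forall x, a < x < b -> is_derive x 1 g (dg x)) ->
  (forall x, a < x < b -> `|df x| <= dg x) ->
  `|f b - f a| <= g b - g a.
Proof.
move=> ab fC gC fD gD dfg.
have H1 : g a - f a <= g b - f b.
  apply: (@ge0_derive_le (fun x => g x - f x) (fun x => dg x - df x)) => //.
  - exact: continuous_sub.
  - by move=> x xab; apply: is_derive_sub; [exact: gD|exact: fD].
  - by move=> x xab; rewrite subr_ge0 (le_trans (ler_norm _)) ?dfg.
have H2 : g a + f a <= g b + f b.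
  apply: (@ge0_derive_le (fun x => g x + f x) (fun x => dg x + df x)) => //.
  - exact: continuous_add.
  - by move=> x xab; apply: is_deriveD; [exact: gD|exact: fD].
  - by move=> x /dfg; rewrite ler_norml => /andP[? _]; lra.
by rewrite ler_norml; apply/andP; split; lra.
Qed.

Lemma derive0_eq f a b : a <= b -> continuous f ->
  (forall x, a < x < b -> is_derive x 1 f 0) -> f b = f a.
Proof.
move=> ab fC fD; apply/eqP; rewrite -subr_eq0 -normr_le0.
rewrite -(subrr (0 : R)).
apply: (@derive_bound f (cst 0) (cst 0) (cst 0)) => //.
- by move=> x; exact: cvg_cst.
- by move=> x _; rewrite normr0.
Qed.

(** The integral starts at -1, so that 0 is an interior point, and negative arguments are replaced
    by 0; this makes [F] continuous on the whole line. *)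
Lemma antiderivative f : continuous f ->
  exists F, [/\ continuous F, F 0 = 0 &
    forall t : R, 0 < t -> is_derive t 1 F (f t)].
Proof.
move=> fC.
pose G x := parameterized_integral lebesgue_measure (-1) x f.
have fi b : lebesgue_measure.-integrable `[-1, b] (EFin \o f).
  apply: continuous_compact_integrable; first exact: segment_compact.
  exact: continuous_subspaceT.
have GD t : -1 < t -> is_derive t 1 G (f t).
  move=> t1; have t1' : t < t + 1 by rewrite ltrDl.
  have [dG GE] := continuous_FTC1_closed t1' (fi _) t1 (fC t).
  by split; [exact: dG|rewrite -derive1E; exact: GE].
have GC t : -1 < t -> {for t, continuous G}.
  by move=> /GD[/derivable1_diffP/differentiable_continuous].
exists (fun x => G (Num.max 0 x) - G 0); split.
- move=> x; apply: cvgB; last exact: cvg_cst.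
  have := @continuous_comp _ _ _ (fun y : R => Num.max 0 y) G x.
  apply; first exact: maxl_continuous.
  by apply: GC; rewrite lt_max ltrN10.
- by rewrite maxxx subrr.
- move=> t t0; apply: (@near_is_derive (fun x => G x - G 0)).
    near=> s; rewrite max_r// ltW//.
    by near: s; exact: lt_nbhsr.
  apply: is_derive_eq (is_derive_sub (GD t _) (is_derive_cst _ _ _)) _.
    by rewrite (lt_trans _ t0) ?ltrN10.
  by rewrite subr0.
Unshelve. all: by end_near. Qed.

End Calculus.

(** * Linear differential equations *)

Section LinearODE.
Context {R : realType}.

(** Serves two limits: that of the Picard iteration and that of the layer width [delta], taken to be
    2^-m. *)
Lemma le_geometric (x y c : R) : (forall k, x <= y + c * 2^-1 ^+ k) -> x <= y.
Proof.
move=> xy; rewrite leNgt; apply/negP => yx.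
have cvg0 : (fun k => y + c * 2^-1 ^+ k) @ \oo --> y.
  rewrite -[X in _ --> X]addr0; apply: cvgD; first exact: cvg_cst.
  rewrite -(mulr0 c); apply: cvgM; first exact: cvg_cst.
  by apply: cvg_expr; rewrite ger0_norm ?invr_ge0// invf_lt1 ?ltr1n.
have : x <= y.
  rewrite -(cvg_lim (@Rhausdorff R) cvg0); apply: limr_ge.
    by apply/cvg_ex; exists y.
  by near=> k; exact: xy.
by rewrite leNgt yx.
Unshelve. all: by end_near. Qed.

(** The intervals of radius 2 c 2^-k around [u k] are nested; the limit is the supremum of their
    left endpoints. *)
Lemma geometric_limit (u : nat -> R) c :
  (forall k, `|u k.+1 - u k| <= c * 2^-1 ^+ k) ->
  exists l, forall k, `|u k - l| <= 2 * c * 2^-1 ^+ k.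
Proof.
move=> uc; pose v k := u k - 2 * c * 2^-1 ^+ k.
pose w k := u k + 2 * c * 2^-1 ^+ k.
have halfE k : 2 * c * 2^-1 ^+ k.+1 = c * 2^-1 ^+ k.
  by rewrite exprS; field.
have vS k : v k <= v k.+1.
  by have := uc k; rewrite /v halfE ler_norml => /andP[? ?]; lra.
have wS k : w k.+1 <= w k.
  by have := uc k; rewrite /w halfE ler_norml => /andP[? ?]; lra.
have vw k : v k <= w k.
  by have := le_trans (normr_ge0 _) (uc k); rewrite /v /w; lra.
have vmono k m : (k <= m)%N -> v k <= v m by move/nondecreasing_seqP : vS; exact.
have wmono k m : (k <= m)%N -> w m <= w k by move/nonincreasing_seqP : wS; exact.
have vwm k m : v k <= w m.
  have [km|/ltnW mk] := leqP k m; first exact: le_trans (vmono _ _ km) (vw m).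
  exact: le_trans (vw k) (wmono _ _ mk).
exists (sup (range v)) => k.
have vsup : v k <= sup (range v).
  by apply: ub_le_sup; [exists (w 0%N) => _ [m _ <-]|exists k].
have supw : sup (range v) <= w k.
  by apply: ge_sup; [exists (v 0%N); exists 0%N|move=> _ [m _ <-]].
by move: vsup supw; rewrite ler_norml /v /w => ? ?; apply/andP; split; lra.
Qed.

Lemma dominated_continuous (f g : R -> R) : continuous g ->
  (forall s t, `|f s - f t| <= `|g s - g t|) -> continuous f.
Proof.
move=> gC fg t; apply/cvgrPdist_le => e e0.
have /cvgrPdist_le /(_ e e0) := gC t; apply: filterS => s.
exact: le_trans.
Qed.

(** The weight exp(2Lx) has derivative 2L times itself, so integrating the bound L c exp(2Lx) costs
    only half of c exp(2Lx). This factor 1/2 drives the Picard iteration. *)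
Lemma exp_growth (f df : R -> R) (L c s t : R) : 0 <= s <= t -> 0 < L ->
  continuous f -> (forall x : R, 0 < x -> is_derive x 1 f (df x)) ->
  (forall x : R, 0 < x -> `|df x| <= L * (c * expR (2 * L * x))) ->
  `|f t - f s| <= c / 2 * expR (2 * L * t) - c / 2 * expR (2 * L * s).
Proof.
move=> /andP[s0 st] L0 fC fD dfL.
have lC : continuous (fun x : R => 2 * L * x).
  by move=> x; apply: cvgM; [exact: cvg_cst|exact: cvg_id].
apply: (@derive_bound R f (fun x => c / 2 * expR (2 * L * x)) df
  (fun x => L * (c * expR (2 * L * x)))) => //.
- apply: continuous_mul; first exact: cst_continuous.
  exact: continuous_comp_fun (@continuous_expR R) lC.
- by move=> x /andP[sx _]; apply: fD; exact: le_lt_trans sx.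
- move=> x _.
  have lD : is_derive x (1 : R) (fun x : R => 2 * L * x) (2 * L).
    apply: is_derive_eq (is_derive_mul (is_derive_cst (2 * L) x 1) (is_derive_id x 1)) _.
    by rewrite /cst; ring.
  have := @is_derive1_comp R expR (fun x => 2 * L * x) x _ _ (is_derive_expR _) lD.
  move=> eD; apply: is_derive_eq (is_derive_mul (is_derive_cst (c / 2) x 1) eD) _.
  by rewrite /cst; field.
- by move=> x /andP[sx _]; apply: dfL; exact: le_lt_trans sx.
Qed.

(** Picard iteration in the norm weighted by exp(-2Lt), in which the integral operator contracts by
    1/2 for all t >= 0 at once. *)
Lemma linear_ode (I : finType) (A : R -> I -> I -> R) (K : R) (y0 : I -> R) :
  (forall i j, continuous (fun t => A t i j)) ->
  (forall t i j, `|A t i j| <= K) ->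
  exists y : R -> I -> R, [/\ forall i, continuous (fun t => y t i),
    forall i, y 0 i = y0 i &
    forall (t : R) i, 0 < t ->
      is_derive t 1 (fun s => y s i) (\sum_j A t i j * y t j)].
Proof.
move=> AC AK.
(* [J] picks an antiderivative vanishing at 0; its value on discontinuous functions is arbitrary. *)
have /choice[J JP] (f : R -> R) : exists F : R -> R, continuous f ->
    [/\ continuous F, F 0 = 0 & forall t : R, 0 < t -> is_derive t 1 F (f t)].
  have [/antiderivative[F FP]|nf] := pselect (continuous f); first by exists F.
  by exists f.
have AyC (y : R -> I -> R) i : (forall j, continuous (fun t => y t j)) ->
    continuous (fun t => \sum_j A t i j * y t j).
  by move=> yC; apply: continuous_bigsum => j; exact: continuous_mul.
pose Phi (y : R -> I -> R) t i := y0 i + J (fun s => \sum_j A s i j * y s j) t.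
have PhiC (y : R -> I -> R) i : (forall j, continuous (fun t => y t j)) ->
    continuous (fun t => Phi y t i).
  move=> /(AyC _ i)/JP[JC _ _]; apply: continuous_add => //.
  exact: cst_continuous.
have PhiD (y : R -> I -> R) i (t : R) : (forall j, continuous (fun t => y t j)) -> 0 < t ->
    is_derive t 1 (fun s => Phi y s i) (\sum_j A t i j * y t j).
  move=> /(AyC _ i)/JP[_ _ JD] /JD JDt.
  by apply: is_derive_eq (is_deriveD (is_derive_cst (y0 i) t 1) JDt) _; rewrite add0r.
have Phi0 (y : R -> I -> R) i : (forall j, continuous (fun t => y t j)) -> Phi y 0 i = y0 i.
  by move=> /(AyC _ i)/JP[_ J0 _]; rewrite /Phi J0 addr0.
pose Y := fix Y k : R -> I -> R := if k is k'.+1 then Phi (Y k') else fun _ => y0.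
have YC k i : continuous (fun t => Y k t i).
  elim: k i => [|k IHk] i /=; first exact: cst_continuous.
  exact: PhiC.
(* [L] dominates the absolute row sums of [A t]; the added 1 keeps it positive. *)
pose L := `|K| * #|I|%:R + 1.
have L0 : 0 < L by rewrite ltr_wpDl ?mulr_ge0.
have AL (t : R) i (z : I -> R) c : (forall j, `|z j| <= c) ->
    `|\sum_j A t i j * z j| <= L * c.
  move=> zc; have c0 := le_trans (normr_ge0 _) (zc i).
  apply: (le_trans (ler_norm_sum _ _ _)).
  apply: (@le_trans _ _ (\sum_(j : I) `|K| * c)).
    apply: ler_sum => j _; rewrite normrM ler_pM//.
    exact: le_trans (AK _ _ _) (ler_norm _).
  rewrite sumr_const -mulr_natr mulrAC ler_wpM2r//.
  by rewrite /L lerDl.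
pose M := \sum_i `|y0 i|.
have M0 : 0 <= M by apply: sumr_ge0.
have y0M i : `|y0 i| <= M.
  by rewrite /M (bigD1 i)//= lerDl sumr_ge0.
pose E t := expR (2 * L * t).
have E1 (t : R) : 0 <= t -> 1 <= E t.
  by move=> t0; rewrite -expR0 ler_expR !mulr_ge0// ltW.
have E0 : E 0 = 1 by rewrite /E mulr0 expR0.
have YM k (t : R) i : 0 <= t -> `|Y k t i| <= M * E t.
  elim: k t i => [|k IHk] t i t0 /=.
    by rewrite (le_trans (y0M i))// ler_peMr ?E1.
  have := @exp_growth (fun t => Phi (Y k) t i) _ L M 0 t _ L0
    (PhiC _ _ (YC k)) (fun x => PhiD _ _ _ (YC k)) _.
  rewrite lexx t0 => /(_ isT) H.
  have {}H := H (fun x x0 => AL _ _ _ _ (fun j => IHk x j (ltW x0))).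
  rewrite Phi0// in H.
  have := y0M i; have := E1 _ t0; move: H; rewrite -/(E _) -/(E _) E0 => H ME yM.
  have := mulr_ge0 M0 (le_trans ler01 ME).
  have -> : Phi (Y k) t i = (Phi (Y k) t i - y0 i) + y0 i by rewrite subrK.
  have := ler_wpM2l M0 ME.
  move=> h1 h2; rewrite (le_trans (ler_normD _ _))//; lra.
(* This modulus of continuity does not depend on [k], so it survives the limit and yields the
   continuity of [y]. *)
have YLip k (s t : R) i : 0 <= s <= t ->
    `|Y k t i - Y k s i| <= M / 2 * E t - M / 2 * E s.
  move=> st; case: k => [|k].
    rewrite subrr normr0 -mulrBr mulr_ge0 ?divr_ge0// subr_ge0 ler_expR.
    by rewrite ler_pM2l ?mulr_gt0//; case/andP: st.
  apply: (@exp_growth (fun t => Phi (Y k) t i) _ L M s t st L0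
    (PhiC _ _ (YC k)) (fun x => PhiD _ _ _ (YC k))) => x x0.
  by apply: AL => j; apply: YM; exact: ltW.
have Phi_dist (y z : R -> I -> R) c (t : R) i : 0 <= t ->
    (forall j, continuous (fun t => y t j)) ->
    (forall j, continuous (fun t => z t j)) ->
    (forall s j, 0 <= s -> `|y s j - z s j| <= c * E s) ->
    `|Phi y t i - Phi z t i| <= c / 2 * E t.
  move=> t0 yC zC yz.
  have c0 : 0 <= c.
    by have := yz 0 i (lexx _); rewrite E0 mulr1; exact: le_trans.
  have := @exp_growth (fun t => Phi y t i - Phi z t i) _ L c 0 t _ L0
    (continuous_sub (PhiC _ _ yC) (PhiC _ _ zC))
    (fun x x0 => is_derive_sub (PhiD _ _ _ yC x0) (PhiD _ _ _ zC x0)) _.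
  rewrite lexx t0 => /(_ isT) H.
  have {}H : `|Phi y t i - Phi z t i - (Phi y 0 i - Phi z 0 i)|
      <= c / 2 * expR (2 * L * t) - c / 2 * expR (2 * L * 0).
    apply: H => x x0; rewrite -sumrB.
    under eq_bigr do rewrite -mulrBr.
    by apply: AL => j; apply: yz; exact: ltW.
  rewrite !Phi0// subrr subr0 in H; apply: (le_trans H).
  by rewrite gerBl mulr_ge0 ?expR_ge0// divr_ge0.
have Ydiff k (t : R) i : 0 <= t -> `|Y k.+1 t i - Y k t i| <= 2 * M * E t * 2^-1 ^+ k.
  elim: k t i => [|k IHk] t i t0.
    rewrite expr0 mulr1 (le_trans (ler_normB _ _))//.
    have := YM 0%N t i t0; have := YM 1%N t i t0; lra.
  rewrite exprS.
  have := @Phi_dist (Y k.+1) (Y k) (2 * M * 2^-1 ^+ k) t i t0 (YC _) (YC _).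
  have H1 (s : R) j : 0 <= s -> `|Y k.+1 s j - Y k s j| <= 2 * M * 2^-1 ^+ k * E s.
    by move=> s0; rewrite mulrAC; exact: IHk.
  move=> /(_ H1) H; apply: (le_trans H).
  by rewrite le_eqVlt; apply/orP; left; apply/eqP; ring.
have /choice[l lP] (p : R * I) : exists l, 0 <= p.1 ->
    forall k, `|Y k p.1 p.2 - l| <= 2 * (2 * M * E p.1) * 2^-1 ^+ k.
  have [p0|] := boolP (0 <= p.1); last by exists 0.
  have [l lP] := @geometric_limit (fun k => Y k p.1 p.2) (2 * M * E p.1)
    (fun k => Ydiff k _ _ p0).
  by exists l.
(* The limits are controlled at nonnegative times only, hence [y] is kept constant before 0. *)
pose y (t : R) i := l (Num.max 0 t, i).
have yE (t : R) i : 0 <= t -> y t i = l (t, i) by move=> t0; rewrite /y max_r.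
have yY (t : R) i k : 0 <= t -> `|Y k t i - y t i| <= 4 * M * 2^-1 ^+ k * E t.
  move=> t0; rewrite yE//; apply: (le_trans (lP (t, i) t0 k)).
  by rewrite le_eqVlt; apply/orP; left; apply/eqP => /=; ring.
have yLip (s t : R) i : 0 <= s <= t -> `|y t i - y s i| <= M / 2 * E t - M / 2 * E s.
  move=> st; have /andP[s0 st'] := st; have t0 := le_trans s0 st'.
  apply: (@le_geometric _ _ (4 * M * E t + 4 * M * E s)) => k.
  have -> : y t i - y s i = (Y k t i - Y k s i) - (Y k t i - y t i)
    + (Y k s i - y s i) by ring.
  rewrite (le_trans (ler_normD _ _))// (le_trans (lerD (ler_normB _ _) (lexx _)))//.
  have := YLip k s t i st; have := yY t i k t0; have := yY s i k s0; lra.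
have yC i : continuous (fun t => y t i).
  apply: (@dominated_continuous _ (fun t => M / 2 * E (Num.max 0 t))).
    apply: continuous_mul; first exact: cst_continuous.
    apply: continuous_comp_fun (@continuous_expR R) _.
    apply: continuous_mul; first exact: cst_continuous.
    exact: maxl_continuous.
  move=> s t; have yM x : y x i = y (Num.max 0 x) i.
    by rewrite /y [Num.max 0 (Num.max 0 x)]max_r // le_max lexx.
  rewrite (yM s) (yM t).
  have : 0 <= Num.max 0 s by rewrite le_max lexx.
  have : 0 <= Num.max 0 t by rewrite le_max lexx.
  move: (Num.max 0 s) (Num.max 0 t) => {}s {}t t0 s0.
  wlog st : s t s0 t0 / s <= t.
    have [st|/ltW ts] := leP s t; first exact.
    by rewrite distrC (distrC (_ * _)); exact.
  rewrite distrC (distrC (_ * _)) (le_trans (yLip _ _ _ _)) ?s0// ler_norm//.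
(* Both [y] and [Phi y] are limits of [Y k.+1]. *)
have yPhi (t : R) i : 0 <= t -> y t i = Phi y t i.
  move=> t0; apply/eqP; rewrite -subr_eq0 -normr_le0.
  apply: (@le_geometric _ _ (4 * M * E t)) => k; rewrite add0r.
  have -> : y t i - Phi y t i = (Y k.+1 t i - Phi y t i) - (Y k.+1 t i - y t i).
    by ring.
  rewrite (le_trans (ler_normB _ _))//.
  have := yY t i k.+1 t0.
  have := @Phi_dist (Y k) y (4 * M * 2^-1 ^+ k) t i t0 (YC _) yC
    (fun s j s0 => yY s j k s0).
  by rewrite exprS -[Phi (Y k)]/(Y k.+1); lra.
exists y; split => // [i|t i t0]; first by rewrite yPhi// Phi0.
apply: near_is_derive (PhiD _ _ _ yC t0).
near=> s; rewrite -yPhi// ltW//.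
by near: s; exact: lt_nbhsr.
Unshelve. all: by end_near. Qed.

End LinearODE.

(** * Propagators of linear systems *)

Section Evolution.
Context {R : realType}.

(** An enumeration of [I] turns kernels into square matrices, for which a one-sided inverse is
    two-sided. *)
Lemma kernel_invC (I : finType) (F G : I -> I -> R) :
  (forall i j, \sum_k F i k * G k j = (i == j)%:R) ->
  forall i j, \sum_k G i k * F k j = (i == j)%:R.
Proof.
move=> FG i j.
pose mx (H : I -> I -> R) : 'M[R]_#|I| :=
  \matrix_(p, q) H (enum_val p) (enum_val q).
have mulE (H H' : I -> I -> R) p q : (mx H *m mx H') p q =
    \sum_k H (enum_val p) k * H' k (enum_val q).
  rewrite mxE (reindex (@enum_val I predT)); last first.
    by apply: onW_bij; exact: enum_val_bij.
  by apply: eq_bigr => k _; rewrite !mxE.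
have /mulmx1C/matrixP/(_ (enum_rank i) (enum_rank j)) : mx F *m mx G = 1%:M.
  apply/matrixP => p q; rewrite mulE FG !mxE.
  by rewrite (inj_eq enum_val_inj).
by rewrite mulE !mxE !enum_rankK (inj_eq enum_rank_inj).
Qed.

(* [P s t] is the propagator from time [s] to time [t] of [y' = A y]. It is
   obtained as [U t * V s] from solutions of [U' = A U] and [V' = - V A], so
   that [V s] is the inverse of [U s]. *)
Lemma evolution_family (I : finType) (A : R -> I -> I -> R) (K : R) :
  (forall i j, continuous (fun t => A t i j)) ->
  (forall t i j, `|A t i j| <= K) ->
  exists P : R -> R -> I -> I -> R, [/\
    forall (t : R) i j, 0 <= t -> P t t i j = (i == j)%:R,
    forall s i j, continuous (fun t => P s t i j),
    forall (s t : R) i j, 0 < t ->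
      is_derive t 1 (fun r => P s r i j) (\sum_k A t i k * P s t k j),
    forall t i j, continuous (fun s => P s t i j) &
    forall (s t : R) i j, 0 < s ->
      is_derive s 1 (fun r => P r t i j) (- \sum_k P s t i k * A s k j)].
Proof.
move=> AC AK.
have /choice[U UP] (j : I) := linear_ode (fun i => (i == j)%:R) AC AK.
have BC i j : continuous (fun t => - A t j i).
  by move=> t; apply: continuousN; exact: AC.
have BK t i j : `|- A t j i| <= K by rewrite normrN.
have /choice[V VP] (i : I) := linear_ode (fun j => (i == j)%:R) BC BK.
have UC i j : continuous (fun t => U j t i) by case: (UP j).
have VC i j : continuous (fun t => V i t j) by case: (VP i).
have UD i j (t : R) : 0 < t ->
    is_derive t 1 (fun s => U j s i) (\sum_k A t i k * U j t k).
  by case: (UP j) => _ _; exact.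
have VD i j (t : R) : 0 < t ->
    is_derive t 1 (fun s => V i s j) (\sum_k - A t k j * V i t k).
  by case: (VP i) => _ _; exact.
(* The equations of [U] and [V] are adjoint up to sign, so the product has derivative zero and
   remains the identity. *)
have VU (t : R) i j : 0 <= t -> \sum_k V i t k * U j t k = (i == j)%:R.
  move=> t0.
  have -> : \sum_k V i t k * U j t k = \sum_k V i 0 k * U j 0 k.
    apply: (@derive0_eq R (fun t => \sum_k V i t k * U j t k) 0 t t0) => [|x /andP[x0 _]].
      by apply: continuous_bigsum => k; exact: continuous_mul.
    apply: is_derive_eq (is_derive_bigsum (fun k =>
      is_derive_mul (VD i k x x0) (UD k j x x0))) _.
    rewrite big_split/=.
    under eq_bigr do rewrite mulr_suml.
    rewrite exchange_big/= -big_split/= big1// => k _.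
    rewrite mulr_sumr -big_split/= big1// => l _.
    by rewrite !mulNr mulrCA mulrA addNr.
  have [_ V0 _] := VP i; have [_ U0 _] := UP j.
  rewrite (bigD1 i)//= V0 U0 eqxx mul1r big1 ?addr0// => k ki.
  by rewrite V0 eq_sym (negPf ki) mul0r.
have UV (t : R) i j : 0 <= t -> \sum_k U k t i * V k t j = (i == j)%:R.
  move=> t0; apply: (@kernel_invC _ (fun i j => V i t j) (fun i j => U j t i)).
  by move=> p q; exact: VU.
exists (fun s t i j => \sum_k U k t i * V k s j); split.
- by move=> t i j; exact: UV.
- move=> s i j; apply: continuous_bigsum => k.
  by apply: continuous_mul => //; exact: cst_continuous.
- move=> s t i j t0.
  apply: is_derive_eq (is_derive_bigsum (fun k =>
    is_derive_mul (UD i k t t0) (is_derive_cst (V k s j) t 1))) _.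
  under eq_bigr do rewrite mulr0 addr0 mulr_suml.
  rewrite exchange_big/=; apply: eq_bigr => l _.
  by rewrite mulr_sumr; apply: eq_bigr => k _; rewrite mulrA.
- move=> t i j; apply: continuous_bigsum => k.
  by apply: continuous_mul => //; exact: cst_continuous.
- move=> s t i j s0.
  apply: is_derive_eq (is_derive_bigsum (fun k =>
    is_derive_mul (is_derive_cst (U k t i) s 1) (VD k j s s0))) _.
  under eq_bigr do rewrite mul0r add0r mulr_sumr.
  rewrite exchange_big/= -sumrN; apply: eq_bigr => l _.
  rewrite mulr_suml -sumrN; apply: eq_bigr => k _.
  by rewrite /cst mulNr mulrN mulrAC mulrA.
Qed.

End Evolution.

(** * Parabolic equations on finite lattices *)

Section Propagator.
Context {R : realType} {n : nat} {V : finZmodType} (step : dir n -> V).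
Hypothesis step_opp : forall e, step (dir_opp e) = - step e.
Variable N : nat.
Implicit Types (a : V -> dir n -> R) (f v : V -> R).

Lemma gen_opp a v x : gen step N a (fun y => - v y) x = - gen step N a v x.
Proof.
rewrite /gen -mulrN -sumrN; congr (_ * _); apply: eq_bigr => e _.
by rewrite -mulrN opprB opprK addrC.
Qed.

(** Summation by parts: by symmetry of [a], the sum is -1/2 N^2 times the sum over x and e of a(x,e)
    (phi(v(x+e)) - phi(v(x))) (v(x+e) - v(x)), whose terms are nonnegative for monotone [phi]. *)
Lemma gen_monotone_le0 (cm cp : R) a v (phi : R -> R) : 0 < cm ->
  elliptic step cm cp a -> {homo phi : x y / x <= y} ->
  \sum_x phi (v x) * gen step N a v x <= 0.
Proof.
move=> cm0 [a_sym a_bnd] phi_mono.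
pose S1 := \sum_x \sum_e a x e * phi (v x) * (v (x + step e) - v x).
pose S2 := \sum_x \sum_e a x e * phi (v (x + step e)) * (v (x + step e) - v x).
have S12 : S1 = - S2.
  rewrite /S1 /S2 !pair_big/= -sumrN.
  (* [h] reverses the oriented edge from x to x + e; [a] is invariant under it and the increment of
     [v] changes sign. *)
  pose h (p : V * dir n) := (p.1 + step p.2, dir_opp p.2).
  have hK : involutive h.
    by case=> x [i b]; rewrite /h/= step_opp addrK /dir_opp/= negbK.
  rewrite (reindex_inj (inv_inj hK)) /=; apply: eq_bigr => -[x e] _ /=.
  by rewrite -a_sym step_opp addrK -mulrN opprB.
have S2S1 : 0 <= S2 - S1.
  rewrite /S2 /S1 -sumrB; apply: sumr_ge0 => x _.
  rewrite -sumrB; apply: sumr_ge0 => e _.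
  rewrite -mulrBl -mulrBr -mulrA mulr_ge0//.
    by have /andP[+ _] := a_bnd x e; apply: le_trans; exact: ltW.
  have [vx|/ltW vx] := leP (v x) (v (x + step e)).
    by rewrite mulr_ge0// subr_ge0// phi_mono.
  by rewrite mulr_le0// subr_le0// phi_mono.
have -> : \sum_x phi (v x) * gen step N a v x = N%:R ^+ 2 * S1.
  rewrite /S1 mulr_sumr; apply: eq_bigr => x _.
  rewrite /gen mulrCA; congr (_ * _); rewrite mulr_sumr.
  by apply: eq_bigr => e _; rewrite mulrA (mulrC (phi _)).
by rewrite mulr_ge0_le0 ?sqr_ge0//; lra.
Qed.

(* [\sum_x exp (k v)] is nonincreasing for every [k >= 0]; let [k] go to
   infinity. *)
Lemma max_principle (cm cp M : R) (a : R -> V -> dir n -> R) (v : R -> V -> R) :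
  0 < cm ->
  (forall t : R, 0 < t -> elliptic step cm cp (a t)) ->
  (forall x, continuous (fun t => v t x)) ->
  (forall (t : R) x, 0 < t ->
    is_derive t 1 (fun s => v s x) (gen step N (a t) (v t) x)) ->
  (forall x, v 0 x <= M) -> forall (t : R) x, 0 <= t -> v t x <= M.
Proof.
move=> cm0 a_ell vC vD v0 t x t0; rewrite leNgt; apply/negP => Mv.
pose d := v t x - M; have d0 : 0 < d by rewrite subr_gt0.
(* One term exp(k v(t,x)) is at most the whole sum, hence at most #|V| exp(k M); divide by exp(k M)
   and use 1 + z <= exp z. Large [k] contradicts this bound. *)
have expk (k : nat) : 1 + k%:R * d <= #|V|%:R.
  have kC y : continuous (fun s => k%:R * v s y).
    by apply: continuous_mul => //; exact: cst_continuous.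
  have : - (\sum_y expR (k%:R * v 0 y)) <= - \sum_y expR (k%:R * v t y).
    apply: (@ge0_derive_le R (fun s => - \sum_y expR (k%:R * v s y))
      (fun s => - (k%:R * (\sum_y expR (k%:R * v s y) * gen step N (a s) (v s) y)))) => //.
    - move=> s; apply: continuousN; apply: continuous_bigsum => y.
      by apply: continuous_comp_fun => //; exact: continuous_expR.
    - move=> s /andP[s0 _]; apply: is_deriveN.
      rewrite mulr_sumr; apply: is_derive_bigsum => y.
      have kD : is_derive s (1 : R) (fun s => k%:R * v s y)
          (k%:R * gen step N (a s) (v s) y).
        apply: is_derive_eq (is_derive_mul (is_derive_cst (k%:R : R) s 1) (vD s y s0)) _.
        by rewrite mul0r add0r.
      have := @is_derive1_comp R expR _ s _ _ (is_derive_expR _) kD.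
      by move=> eD; apply: is_derive_eq eD _; rewrite mulrCA.
    - move=> s /andP[s0 _]; rewrite oppr_ge0 mulr_ge0_le0//.
      apply: (@gen_monotone_le0 cm cp (a s) (v s) (fun z => expR (k%:R * z))) => //.
        exact: a_ell.
      by move=> y z yz; rewrite ler_expR ler_wpM2l.
  rewrite lerN2 => sum_le.
  have : expR (k%:R * v t x) <= #|V|%:R * expR (k%:R * M).
    apply: (@le_trans _ _ (\sum_y expR (k%:R * v t y))).
      by rewrite (bigD1 x)//= lerDl sumr_ge0// => y _; exact: expR_ge0.
    apply: (le_trans sum_le); rewrite mulr_natl -sumr_const ler_sum// => y _.
    by rewrite ler_expR ler_wpM2l.
  rewrite -ler_pdivrMr ?expR_gt0// -expRN -expRD -mulrN -mulrDr.
  by apply: le_trans; exact: expR_ge1Dx.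
have := expk (Num.truncn (#|V|%:R / d)).+1.
apply/negP; rewrite -ltNge.
have : #|V|%:R / d < (Num.truncn (#|V|%:R / d)).+1%:R by exact: truncnS_gt.
by rewrite ltr_pdivrMr// => h; rewrite (lt_trans h)// ltrDr.
Qed.

Lemma max_principle_norm (cm cp M : R) (a : R -> V -> dir n -> R)
  (v : R -> V -> R) : 0 < cm ->
  (forall t : R, 0 < t -> elliptic step cm cp (a t)) ->
  (forall x, continuous (fun t => v t x)) ->
  (forall (t : R) x, 0 < t ->
    is_derive t 1 (fun s => v s x) (gen step N (a t) (v t) x)) ->
  (forall x, `|v 0 x| <= M) -> forall (t : R) x, 0 <= t -> `|v t x| <= M.
Proof.
move=> cm0 a_ell vC vD v0 t x t0; rewrite ler_norml lerNl; apply/andP; split.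
  apply: (@max_principle cm cp M a (fun t x => - v t x)) => //.
  - by move=> y s; apply: continuousN; exact: vC.
  - by move=> s y s0; rewrite gen_opp; apply: is_deriveN; exact: vD.
  - by move=> y; rewrite lerNl; have := v0 y; rewrite ler_norml => /andP[].
apply: (max_principle cm0 a_ell vC vD _ _ t0) => y.
exact: le_trans (ler_norm _) (v0 y).
Qed.

(** The matrix of the generator. Kronecker symbols allow several directions to lead to the same
    point, or back to [x], as happens on tori with N <= 2. *)
Definition gen_kernel a (x y : V) : R :=
  N%:R ^+ 2 * \sum_e a x e * ((x + step e == y)%:R - (x == y)%:R).

Lemma gen_kernelE a v x : \sum_y gen_kernel a x y * v y = gen step N a v x.
Proof.
have pick z : \sum_y (z == y)%:R * v y = v z.
  rewrite (bigD1 z)//= eqxx mul1r big1 ?addr0// => y yz.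
  by rewrite eq_sym (negPf yz) mul0r.
rewrite /gen /gen_kernel; under eq_bigr do rewrite -mulrA mulr_suml.
rewrite -mulr_sumr exchange_big/=; congr (_ * _); apply: eq_bigr => e _.
under eq_bigr do rewrite -mulrA mulrBl.
by rewrite -mulr_sumr sumrB !pick.
Qed.

(** The fourth clause is Duhamel's formula in differential form: the generator acting on [w] cancels
    against the backward derivative of the propagator, leaving the source [f]. The last clause is
    the maximum principle after a time shift by [s]. *)
Lemma propagator (cm cp : R) (a : R -> V -> dir n -> R) : 0 < cm ->
  (forall x e, continuous (fun t => a t x e)) ->
  (forall t, elliptic step cm cp (a t)) ->
  exists S : R -> R -> (V -> R) -> V -> R, [/\
    forall (t : R) f x, 0 <= t -> S t t f x = f x,
    forall s f x, continuous (fun t => S s t f x) /\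
      forall t : R, 0 < t ->
        is_derive t 1 (fun r => S s r f x) (gen step N (a t) (S s t f) x),
    forall t x (w : R -> V -> R), (forall y, continuous (fun s => w s y)) ->
      continuous (fun s => S s t (w s) x),
    forall (s t : R) x (w : R -> V -> R) f, 0 < s ->
      (forall y, is_derive s 1 (fun r => w r y)
        (gen step N (a s) (w s) y + f y)) ->
      is_derive s 1 (fun r => S r t (w r) x) (S s t f x) &
    forall (s t M : R) f x, 0 <= s <= t -> (forall y, `|f y| <= M) ->
      `|S s t f x| <= M].
Proof.
move=> cm0 aC a_ell.
have AC x y : continuous (fun t => gen_kernel (a t) x y).
  apply: continuous_mul; first exact: cst_continuous.
  apply: continuous_bigsum => e; apply: continuous_mul => //.
  exact: cst_continuous.
have AK t x y : `|gen_kernel (a t) x y| <= N%:R ^+ 2 * \sum_(e : dir n) cp.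
  rewrite /gen_kernel normrM ger0_norm ?sqr_ge0// ler_wpM2l ?sqr_ge0//.
  apply: (le_trans (ler_norm_sum _ _ _)); apply: ler_sum => e _.
  have [_ /(_ x e)/andP[ca ac]] := a_ell t.
  have a0 := le_trans (ltW cm0) ca.
  rewrite normrM (ger0_norm a0) -[leRHS]mulr1 ler_pM//.
  by case: eqP; case: eqP => _ _; rewrite ?subrr ?subr0 ?sub0r ?normrN ?normr0 ?normr1.
have [P [P1 PC PD PC' PD']] := evolution_family AC AK.
exists (fun s t f x => \sum_y P s t x y * f y).
have SC s f x : continuous (fun t => \sum_y P s t x y * f y).
  apply: continuous_bigsum => y; apply: continuous_mul => //.
  exact: cst_continuous.
have SD s f x (t : R) : 0 < t -> is_derive t 1 (fun r => \sum_y P s r x y * f y)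
    (gen step N (a t) (fun z => \sum_y P s t z y * f y) x).
  move=> t0; apply: is_derive_eq (is_derive_bigsum (fun y =>
    is_derive_mul (PD s t x y t0) (is_derive_cst (f y) t 1))) _.
  rewrite -gen_kernelE; under eq_bigr do rewrite mulr0 addr0 mulr_suml.
  rewrite exchange_big/=; apply: eq_bigr => z _.
  by rewrite mulr_sumr; apply: eq_bigr => y _; rewrite mulrA.
have S1 (t : R) f x : 0 <= t -> \sum_y P t t x y * f y = f x.
  move=> t0; rewrite (bigD1 x)//= P1// eqxx mul1r big1 ?addr0// => y yx.
  by rewrite P1// eq_sym (negPf yx) mul0r.
split => //.
- by move=> s f x; split; [exact: SC|move=> t; exact: SD].
- move=> t x w wC; apply: continuous_bigsum => y.
  by apply: continuous_mul => //.
- move=> s t x w f s0 wD.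
  apply: is_derive_eq (is_derive_bigsum (fun y =>
    is_derive_mul (PD' s t x y s0) (wD y))) _.
  rewrite big_split/=.
  under [X in _ + X]eq_bigr do rewrite mulrDr -gen_kernelE.
  rewrite [X in _ + X]big_split/= addrA [X in X + _](_ : _ = 0) ?add0r//.
  under eq_bigr do rewrite mulNr mulr_suml.
  rewrite sumrN exchange_big/= -sumrN -big_split/= big1// => y _.
  rewrite mulr_sumr; apply/eqP; rewrite addrC subr_eq0; apply/eqP.
  by apply: eq_bigr => z _; rewrite mulrA.
- move=> s t M f x /andP[s0 st] fM.
  have ts0 : 0 <= t - s by rewrite subr_ge0.
  have := @max_principle_norm cm cp M (fun r => a (r + s))
    (fun r x => \sum_y P s (r + s) x y * f y) cm0 _ _ _ _ (t - s) x ts0.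
  rewrite subrK; apply.
  + by move=> r _; exact: a_ell.
  + move=> y r; apply: (@continuous_comp _ _ _ (fun r => r + s)
      (fun t => \sum_z P s t y z * f z)); last exact: SC.
    by apply: cvgD; [exact: cvg_id|exact: cvg_cst].
  + move=> r y r0; have rs0 : 0 < r + s by rewrite ltr_wpDr.
    exact: (@is_derive_translate R _ r s _ (SD s f y _ rs0)).
  + by move=> y; rewrite add0r S1.
Qed.

End Propagator.

(** * The Nash estimate on the torus *)

Section TorusLift.
Variables n N : nat.
Implicit Types (x y : torus n N) (z k : 'rV[int]_n).

(** The quotient map, written so that the image of a unit vector is [torus_step] by conversion. *)
Definition torus_proj (z : 'rV[int]_n) : torus n N :=
  map_mx (fun k : int => (inZp 1 : 'I_N.-1.+1) *~ k) z.

Lemma torus_projD z k : torus_proj (z + k) = torus_proj z + torus_proj k.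
Proof. by apply/rowP => i; rewrite !mxE mulrzDr. Qed.

Lemma torus_step_opp (e : dir n) :
  @torus_step n N (dir_opp e) = - @torus_step n N e.
Proof.
by rewrite /torus_step unit_vec_opp; apply/rowP => i; rewrite !mxE mulrNz.
Qed.

Definition torus_lift (x : torus n N) : 'rV[int]_n :=
  map_mx (fun k : 'I_N.-1.+1 => (k : nat)%:Z) x.

Lemma torus_liftK x k : (0 < N)%N -> torus_proj (torus_lift x + N%:Z *: k) = x.
Proof.
move=> N0; rewrite torus_projD; apply/rowP => i; rewrite !mxE.
rewrite -[LHS]/(_ + _) -pmulrn Zp_mulrn mulrzA -pmulrn [_ *+ N](_ : _ = 0).
  rewrite mul0rz addr0; apply/val_inj => /=.
  by rewrite modnMml mul1n modn_small// ltn_ord.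
by apply/val_inj; rewrite Zp_mulrn /= modnMml mul1n prednK// modnn.
Qed.

(** Convertible with the local function [pos] of [torus_dist]. *)
Definition torus_pos (R : realType) (x : torus n N) : 'rV[R]_n :=
  map_mx (fun k : 'I_N.-1.+1 => (k : nat)%:R / N%:R) x.

(** Moving the lift of [x] by the period [N k] produces all the lengths whose infimum is the torus
    distance. *)
Lemma lattice_dist_lift (R : realType) x y k : (0 < N)%N ->
  lattice_dist R N (torus_lift x + N%:Z *: k) (torus_lift y + N%:Z *: 0) =
  enorm (torus_pos R x - torus_pos R y + map_mx intr k).
Proof.
move=> N0; congr enorm; apply/rowP => i; rewrite !mxE.
rewrite mulr0 addr0 rmorphB rmorphD rmorphM /= !pmulrn.
by field; rewrite pnatr_eq0 -lt0n.
Qed.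

End TorusLift.

Section TorusNash.
Context {R : realType}.

(** The Nash estimate is applied to the periodic lifts, whose boundedness comes from the maximum
    principle. The translation [k] stays free, so that the infimum over [k] can be taken at the very
    end. The absolute value of the Nash constant is taken because its sign is not prescribed. *)
Lemma torus_nash (n : nat) (cm cp sigma : R) : 0 < cm ->
  nash_exponent n cm cp sigma ->
  exists2 C : R, 0 <= C & forall (N : nat) (a : R -> torus n N -> dir n -> R)
      (v : R -> torus n N -> R) (M : R),
    (0 < N)%N ->
    (forall x e, continuous (fun t => a t x e)) ->
    (forall t, elliptic (@torus_step n N) cm cp (a t)) ->
    (forall x, continuous (fun t => v t x)) ->
    (forall (t : R) x, 0 < t -> is_derive t 1 (fun s => v s x)
      (gen (@torus_step n N) N (a t) (v t) x)) ->
    (forall x, `|v 0 x| <= M) ->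
    forall (t s : R) x y (k : 'rV[int]_n), 0 < t -> 0 < s ->
    `|v t x - v s y| <= C * M *
      (Num.max (Num.sqrt `|t - s|)
         (enorm (torus_pos R x - torus_pos R y + map_mx intr k))
       / Num.sqrt (Num.min t s)) `^ sigma.
Proof.
move=> cm0 [_ [C CP]]; exists `|C| => // N a v M N0 aC a_ell vC vD v0 t s x y k t0 s0.
have vM := @max_principle_norm R n ('rV['I_N.-1.+1]_n : finZmodType)
  (@torus_step n N) (@torus_step_opp n N) N cm cp M a v cm0
  (fun t _ => a_ell t) vC vD v0.
have genE (r : R) z : gen (@unit_vec n) N (fun z => a r (torus_proj N z))
    (fun z => v r (torus_proj N z)) z = gen (@torus_step n N) N (a r) (v r) (torus_proj N z).
  rewrite /gen; congr (_ * _); apply: eq_bigr => e _.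
  by rewrite torus_projD.
have := CP N (fun t z => a t (torus_proj N z)) (fun z => v 0 (torus_proj N z))
  (fun t z => v t (torus_proj N z)) N0.
have bnd0 : [bounded v 0 (torus_proj N z) | z in [set: 'rV[int]_n]].
  exists M; split; first exact: num_real.
  by move=> B MB z _ /=; exact: le_trans (v0 _) (ltW MB).
have bnd : [bounded v z.1 (torus_proj N z.2) |
    z in `[0, +oo[ `*` [set: 'rV[int]_n]].
  exists M; split; first exact: num_real.
  move=> B MB [r z] [/= +  _]; rewrite in_itv /= andbT => r0.
  exact: le_trans (vM _ _ r0) (ltW MB).
have aC' (z : 'rV[int]_n) e :
    {within `[0, +oo[, continuous (fun t => a t (torus_proj N z) e)}.
  exact: continuous_subspaceT.
have a_ell' (r : R) : 0 <= r ->
    elliptic (@unit_vec n) cm cp (fun z => a r (torus_proj N z)).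
  move=> _; have [as_ ab] := a_ell r; split => z e //.
  by rewrite torus_projD; exact: as_.
have sol : is_solution (@unit_vec n) N `[0, +oo[
    (fun t z => a t (torus_proj N z)) (fun _ _ => 0)
    (fun t z => v t (torus_proj N z)).
  split=> [z|r z]; first exact: continuous_subspaceT.
  rewrite interior_itv /= in_itv /= andbT => r0.
  by rewrite addr0 genE; exact: vD.
move=> /(_ aC' a_ell' bnd0 sol bnd erefl t s
  (torus_lift x + N%:Z *: k) (torus_lift y + N%:Z *: 0) t0 s0).
rewrite (torus_liftK x k N0) (torus_liftK y 0 N0) (lattice_dist_lift R x y k N0).
move=> /le_trans; apply.
rewrite ler_wpM2r ?powR_ge0//.
have M0 := le_trans (normr_ge0 _) (v0 x).
set m := sup_norm _ _.
have mM : m <= M.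
  by apply: ge_sup => [|_ [z _ <-] //]; exists `|v 0 (torus_proj N 0)|; exists 0.
have m0 : 0 <= m.
  apply: le_trans (normr_ge0 (v 0 (torus_proj N 0))) _.
  by apply: ub_le_sup; [exists M => _ [z _ <-]|exists 0].
by rewrite (le_trans (ler_wpM2r m0 (ler_norm C)))// ler_wpM2l.
Qed.

End TorusNash.

(** * Continuation to earlier times *)

Section Interpolation.
Context {R : realType}.
Implicit Types (q p sigma : R).

Lemma clamp_continuous (f : R -> R) (a b : R) : a <= b ->
  {within `[a, b], continuous f} ->
  continuous (fun t => f (Num.max a (Num.min b t))).
Proof.
move=> ab fC t.
have cC : continuous (fun t : R => Num.max a (Num.min b t)).
  exact: continuous_comp_fun (@maxl_continuous R a) (@minl_continuous R b).
have cab s : `[a, b]%classic (Num.max a (Num.min b s)).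
  by rewrite /= in_itv /= le_max lexx /= ge_max ab ge_min lexx.
have /subspace_continuousP /(_ _ (cab t)) fCt := fC.
apply: cvg_comp fCt => A /= /(cC t); rewrite !nbhs_simpl /=.
by apply: filterS => s; apply; exact: cab.
Qed.

Lemma powR_split q sigma : 0 < q -> q `^ sigma * q `^ (1 - sigma) = q.
Proof.
move=> q0; rewrite -powRD; last by rewrite (gt_eqF q0) implybT.
by rewrite subrKC powRr1// ltW.
Qed.

Lemma le_powR_interp q p sigma : sigma < 1 -> 0 <= q <= p ->
  q <= q `^ sigma * p `^ (1 - sigma).
Proof.
move=> s1 /andP[]; rewrite le_eqVlt => /predU1P[<- _|q0 qp].
  by rewrite mulr_ge0 ?powR_ge0.
rewrite -[leLHS](powR_split sigma q0) ler_wpM2l ?powR_ge0//.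
have p0 := lt_le_trans q0 qp.
by apply: ge0_ler_powR => //; rewrite ?nnegrE ?subr_ge0 ltW.
Qed.

(** Here q^-sigma = q^(1-sigma) / q <= p^(1-sigma) / q. With q = sqrt(s1 - s) the singularity in
    time becomes an inverse square root whatever [sigma] is, and this has an explicit
    antiderivative. *)
Lemma powR_div_interp (d q p sigma : R) : sigma < 1 -> 0 <= d -> 0 < q <= p ->
  (d / q) `^ sigma <= d `^ sigma * p `^ (1 - sigma) / q.
Proof.
move=> s1 d0 /andP[q0 qp].
have qi0 : 0 <= q^-1 by rewrite invr_ge0 ltW.
rewrite powRM// -mulrA ler_wpM2l ?powR_ge0// ler_pdivlMr//.
rewrite -powR_inv1 ?(ltW q0)// -powRrM mulN1r powRN -[X in _ * X](powR_split sigma q0).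
rewrite mulKf ?gt_eqF ?powR_gt0//.
have p0 := lt_le_trans q0 qp.
by apply: ge0_ler_powR => //; rewrite ?nnegrE ?subr_ge0 ltW.
Qed.

End Interpolation.

Section Extension.
Context {R : realType} {n N : nat}.
Variables (cm cp T delta : R) (a : R -> torus n N -> dir n -> R)
  (u : R -> torus n N -> R).
Hypotheses (cmp : cm <= cp) (T0 : 0 < T)
  (delta01 : 0 < delta <= 1)
  (a_ell : forall t, 0 <= t <= T -> elliptic (@torus_step n N) cm cp (a t))
  (aC : forall x e, {within `[0, T], continuous (fun t => a t x e)}).

(** [clamp] undoes the time shift and projects onto [0, T], so that the extended functions are
    defined and continuous at all times; [ramp] rises from 0 to 1 on [1 - delta, 1]. *)
Let clamp (s : R) := Num.max 0 (Num.min T (s - 1)).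
Let ramp (s : R) := Num.max 0 (Num.min 1 ((s - (1 - delta)) / delta)).

(* Time is shifted by [1]. The coefficients are extended by the constant [cm]
   before time [1 - delta], and interpolated on [[1 - delta, 1]] because the
   Nash estimate requires continuity in time. *)
Definition ext_coef (s : R) x e := cm + ramp s * (a (clamp s) x e - cm).

Definition ext_sol (s : R) x := u (clamp s) x.

Let clampP s : 0 <= clamp s <= T.
Proof. by rewrite /clamp le_max lexx /= ge_max ge_min lexx /= ltW. Qed.

Let subr1_continuous : continuous (fun s : R => s - 1).
Proof. by move=> s; apply: cvgB; [exact: cvg_id|exact: cvg_cst]. Qed.

Lemma ext_coef_continuous x e : continuous (fun s => ext_coef s x e).
Proof.
apply: continuous_add; first exact: cst_continuous.
apply: continuous_mul.
  apply: (@continuous_comp_fun R (Num.max 0)); first exact: maxl_continuous.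
  apply: (@continuous_comp_fun R (Num.min 1)); first exact: minl_continuous.
  apply: continuous_mul; last exact: cst_continuous.
  by move=> s; apply: cvgB; [exact: cvg_id|exact: cvg_cst].
apply: continuous_sub; last exact: cst_continuous.
exact: continuous_comp_fun (clamp_continuous (ltW T0) (@aC x e)) subr1_continuous.
Qed.

(** A convex combination of the constant [cm] and admissible coefficients is admissible. *)
Lemma ext_coef_elliptic s : elliptic (@torus_step n N) cm cp (ext_coef s).
Proof.
have [a_sym a_bnd] := a_ell (clampP s); split => x e.
  by rewrite /ext_coef -a_sym.
have /andP[ca ac] := a_bnd x e.
have r0 : 0 <= ramp s by rewrite /ramp le_max lexx.
have r1 : ramp s <= 1 by rewrite /ramp ge_max ler01 ge_min lexx.
rewrite /ext_coef lerDl mulr_ge0 ?subr_ge0//=.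
have : ramp s * (a (clamp s) x e - cm) <= a (clamp s) x e - cm.
  by rewrite ler_piMl// subr_ge0.
by lra.
Qed.

Lemma ext_coef_before s : s <= 1 - delta -> ext_coef s = fun _ _ => cm.
Proof.
move=> sd; apply/funext => x; apply/funext => e; rewrite /ext_coef /ramp.
have /andP[d0 _] := delta01.
have h : (s - (1 - delta)) / delta <= 0.
  by rewrite pmulr_lle0 ?invr_gt0// subr_le0.
by rewrite max_l ?mul0r ?addr0// ge_min h orbT.
Qed.

Lemma ext_coef_after s : 1 <= s <= 1 + T -> ext_coef s = a (s - 1).
Proof.
move=> /andP[s1 sT]; apply/funext => x; apply/funext => e; rewrite /ext_coef.
have /andP[d0 _] := delta01.
have -> : ramp s = 1.
  rewrite /ramp min_l ?max_r// ler_pdivlMr// mul1r; lra.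
have -> : clamp s = s - 1 by rewrite /clamp min_r ?max_r//; lra.
by rewrite mul1r addrC subrK.
Qed.

Lemma ext_sol_before s : s <= 1 -> ext_sol s = u 0.
Proof.
move=> s1; apply/funext => x; rewrite /ext_sol /clamp max_l//.
by rewrite ge_min subr_le0 s1 orbT.
Qed.

Lemma ext_sol_after s : 1 <= s <= 1 + T -> ext_sol s = u (s - 1).
Proof.
move=> /andP[s1 sT]; apply/funext => x; rewrite /ext_sol.
by have -> : clamp s = s - 1 by rewrite /clamp min_r ?max_r//; lra.
Qed.

Section Solution.
Variable g : R -> torus n N -> R.
Hypothesis u_sol : is_solution (@torus_step n N) N `[0, T] a g u.

Lemma ext_sol_continuous x : continuous (fun s => ext_sol s x).
Proof.
have [uC _] := u_sol.
exact: continuous_comp_fun (clamp_continuous (ltW T0) (uC x)) subr1_continuous.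
Qed.

(** The derivative is zero; it is split into generator plus source, the form required by Duhamel's
    formula. *)
Lemma ext_sol_derive_before (s : R) x : 0 < s < 1 ->
  is_derive s 1 (fun r => ext_sol r x)
    (gen (@torus_step n N) N (ext_coef s) (ext_sol s) x
     + - gen (@torus_step n N) N (ext_coef s) (u 0) x).
Proof.
move=> /andP[s0 s1]; rewrite ext_sol_before ?ltW// subrr.
apply: near_is_derive (is_derive_cst (u 0 x) s 1).
near=> r; rewrite ext_sol_before// ltW//.
by near: r; exact: lt_nbhsl.
Unshelve. all: by end_near. Qed.

Lemma ext_sol_derive_after (s : R) x : 1 < s < 1 + T ->
  is_derive s 1 (fun r => ext_sol r x)
    (gen (@torus_step n N) N (ext_coef s) (ext_sol s) x + g (s - 1) x).
Proof.
move=> /andP[s1 sT]; have [_ uD] := u_sol.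
have s1T : 1 <= s <= 1 + T by rewrite !ltW.
rewrite ext_sol_after// ext_coef_after//.
have st : (`[0, T]%classic)° (s - 1).
  by rewrite interior_itv /= in_itv /=; apply/andP; split; lra.
apply: near_is_derive (@is_derive_translate R (fun t => u t x) s (-1) _ (uD _ x st)).
near=> r; rewrite ext_sol_after//.
apply/andP; split; apply: ltW.
  by near: r; exact: lt_nbhsr.
by near: r; exact: lt_nbhsl.
Unshelve. all: by end_near. Qed.

End Solution.
End Extension.

(** * The Hölder estimate *)

Section HolderEstimate.
Context {R : realType}.

(** A crude bound growing like N^2, sufficient on the interpolation layer, whose length tends to 0
    with N fixed. *)
Lemma gen_bound (n : nat) (V : zmodType) (step : dir n -> V) (N : nat)
    (cm cp M : R) (a : V -> dir n -> R) (v : V -> R) x :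
  0 < cm -> elliptic step cm cp a -> (forall y, `|v y| <= M) ->
  `|gen step N a v x| <= N%:R ^+ 2 * \sum_(e : dir n) cp * (2 * M).
Proof.
move=> cm0 [_ a_bnd] vM; rewrite /gen normrM ger0_norm ?sqr_ge0//.
rewrite ler_wpM2l ?sqr_ge0//; apply: (le_trans (ler_norm_sum _ _ _)).
apply: ler_sum => e _; have /andP[ca ac] := a_bnd x e.
rewrite normrM ger0_norm ?(le_trans (ltW cm0))// ler_pM//.
  exact: le_trans (ltW cm0) ca.
have := ler_normB (v (x + step e)) (v x).
have := vM (x + step e); have := vM x; lra.
Qed.

Lemma enorm_ge0 (n : nat) (v : 'rV[R]_n) : 0 <= enorm v.
Proof. exact: sqrtr_ge0. Qed.

(** Antiderivative of the inverse square root singularity. It remains continuous at [c], so bounds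
    can be integrated up to the singular time. *)
Lemma is_derive_sqrt_from (c s : R) : s < c ->
  is_derive s 1 (fun r => - (2 * Num.sqrt (c - r))) (Num.sqrt (c - s))^-1.
Proof.
move=> sc; have cs0 : 0 < c - s by rewrite subr_gt0.
have cD : is_derive s (1 : R) (fun r : R => c - r) (-1).
  by apply: is_derive_eq (is_derive_sub (is_derive_cst c s 1) (is_derive_id s 1)) _; rewrite sub0r.
have sD := @is_derive1_comp R Num.sqrt (fun r => c - r) s _ _ (is_derive1_sqrt cs0) cD.
have mD := is_derive_mul (is_derive_cst (2 : R) s 1) sD.
apply: is_derive_eq (is_deriveN mD) _.
by rewrite /cst; field; rewrite gt_eqF// sqrtr_gt0.
Qed.

Lemma sqrt_from_continuous (c : R) :
  continuous (fun r => - (2 * Num.sqrt (c - r))).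
Proof.
have cC : continuous (fun r : R => c - r).
  by move=> r; apply: cvgB; [exact: cvg_cst|exact: cvg_id].
have sC := continuous_comp_fun (@sqrt_continuous R) cC.
by move=> s; apply: cvgN; exact: (continuous_mul (@cst_continuous _ _ (2 : R)) sC).
Qed.

Lemma holder_estimate (n : nat) (cm cp sigma T : R) :
  0 < cm -> cm <= cp -> nash_exponent n cm cp sigma -> 0 < T ->
  exists2 C : R, 0 <= C & forall (N : nat) (a : R -> torus n N -> dir n -> R)
      (g u : R -> torus n N -> R) (G U H : R),
    (0 < N)%N ->
    (forall t, 0 <= t <= T -> elliptic (@torus_step n N) cm cp (a t)) ->
    (forall x e, {within `[0, T], continuous (fun t => a t x e)}) ->
    (forall t x, 0 <= t <= T -> `|g t x| <= G) ->
    is_solution (@torus_step n N) N `[0, T] a g u ->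
    (forall x, `|u 0 x| <= U) ->
    (forall x, `|gen (@torus_step n N) N (fun _ _ => cm) (u 0) x| <= H) ->
    forall (t1 t2 : R) x1 x2 (k : 'rV[int]_n), 0 <= t1 -> t1 <= t2 -> t2 <= T ->
    `|u t1 x1 - u t2 x2| <= C * (G + U + H) *
      (Num.sqrt (t2 - t1) `^ sigma +
       enorm (torus_pos R x1 - torus_pos R x2 + map_mx intr k) `^ sigma).
Proof.
move=> cm0 cmp nash T0; have [/andP[sg0 sg1] _] := nash.
have [C1 C10 C1P] := torus_nash cm0 nash.
(* The factor p^(1-sigma) of [powR_div_interp], with p = sqrt(1 + T) because no elapsed time exceeds
   1 + T. *)
pose Q := Num.sqrt (1 + T) `^ (1 - sigma).
have Q0 : 0 <= Q by exact: powR_ge0.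
pose W := Num.sqrt (1 + T).
have W0 : 0 <= W by exact: sqrtr_ge0.
(* [Q * C1] comes from the initial value, [2 * C1 * Q * W] from integrating the Nash bound against
   the sources up to [s1], and [Q * W] from the source between [s1] and [s2]. *)
exists (Q * (C1 + 2 * C1 * W + W)) => [|N a g u G U H N0 a_ell aC gG u_sol uU uH].
  by rewrite mulr_ge0// !addr_ge0// !mulr_ge0.
move=> t1 t2 x1 x2 k t10 t12 t2T.
set d := enorm _; have d0 : 0 <= d by exact: enorm_ge0.
set r := Num.sqrt (t2 - t1); have r0 : 0 <= r by exact: sqrtr_ge0.
have G0 : 0 <= G by apply: le_trans (gG 0 0 _) => //; rewrite lexx ltW.
have U0 : 0 <= U by apply: le_trans (uU 0).
have H0 : 0 <= H by apply: le_trans (uH 0).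
pose D := (Num.max r d) `^ sigma.
have D0 : 0 <= D by exact: powR_ge0.
have DE : D <= r `^ sigma + d `^ sigma.
  by rewrite /D; case: (leP r d) => _; [rewrite lerDr|rewrite lerDl]; exact: powR_ge0.
pose K := N%:R ^+ 2 * \sum_(e : dir n) cp * (2 * U).
have K0 : 0 <= K.
  rewrite mulr_ge0 ?sqr_ge0// sumr_ge0// => e _.
  by rewrite !mulr_ge0// (le_trans _ cmp)// ltW.
pose s1 := 1 + t1; pose s2 := 1 + t2.
have s11 : 1 <= s1 by rewrite lerDl.
have s12 : s1 <= s2 by rewrite lerD2l.
have s2T : s2 <= 1 + T by rewrite lerD2l.
(* The constant [K] depends on N, but occurs only multiplied by [delta]. *)
have layer (delta : R) : 0 < delta <= 1 ->
    `|u t1 x1 - u t2 x2| <= C1 * U * (D * Q) +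
      (C1 * (G + H) * (D * Q) * (2 * W) + 2 * K * delta) + G * (t2 - t1).
  move=> delta01; have /andP[delta0 delta1] := delta01.
  have bC x e : continuous (fun s => ext_coef cm T delta a s x e).
    exact: ext_coef_continuous.
  have b_ell s : elliptic (@torus_step n N) cm cp (ext_coef cm T delta a s).
    exact: ext_coef_elliptic.
  have wC x : continuous (fun s => ext_sol T u s x).
    exact: ext_sol_continuous u_sol _.
  set b := ext_coef cm T delta a in bC b_ell *; set w := ext_sol T u in wC *.
  have w_before (s : R) : s <= 1 -> w s = u 0 by move=> ?; exact: ext_sol_before.
  have w_after (s : R) : 1 <= s <= 1 + T -> w s = u (s - 1) by move=> ?; exact: ext_sol_after.
  have [S [S1 SCD SwC SwD SM]] := @propagator R n ('rV['I_N.-1.+1]_n : finZmodType)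
    (@torus_step n N) (@torus_step_opp n N) N cm cp b cm0 bC b_ell.
  (* Nash estimate for the propagator started at [s]. The elapsed times [s1 - s] and [s2 - s] always
     differ by [t2 - t1], so [D] serves for every [s]. *)
  have key (s M : R) f : 0 <= s < s1 -> (forall y, `|f y| <= M) ->
      `|S s s1 f x1 - S s s2 f x2| <= C1 * M * (D * Q) * (Num.sqrt (s1 - s))^-1.
    move=> /andP[s0 ss1] fM; have M0 := le_trans (normr_ge0 _) (fM 0).
    have := C1P N (fun t => b (t + s)) (fun t x => S s (t + s) f x) M N0 _ _ _ _ _
      (s1 - s) (s2 - s) x1 x2 k.
    rewrite !subrK => /(_ _ _ _ _ _ _ _)/le_trans; apply.
    - move=> x e t; apply: (@continuous_comp _ _ _ (fun t => t + s)
        (fun t => b t x e)); last exact: bC.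
      by apply: cvgD; [exact: cvg_id|exact: cvg_cst].
    - by move=> t; exact: b_ell.
    - move=> x t; apply: (@continuous_comp _ _ _ (fun t => t + s)
        (fun t => S s t f x)); last by case: (SCD s f x) => + _; exact.
      by apply: cvgD; [exact: cvg_id|exact: cvg_cst].
    - move=> t x t0; have ts0 : 0 < t + s by rewrite ltr_wpDr.
      by case: (SCD s f x) => _ /(_ _ ts0); exact: is_derive_translate.
    - by move=> x; rewrite add0r S1.
    - by rewrite subr_gt0.
    - by rewrite subr_gt0 (lt_le_trans ss1).
    rewrite min_l ?lerD2r//.
    have -> : s1 - s - (s2 - s) = - (t2 - t1) by rewrite /s1 /s2; ring.
    rewrite normrN ger0_norm ?subr_ge0// -/r -/d -[leRHS]mulrA.
    rewrite ler_wpM2l ?mulr_ge0//; apply: powR_div_interp => //.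
      by rewrite le_max r0.
    rewrite sqrtr_gt0 subr_gt0 ss1 ler_wsqrtr//.
    by rewrite (le_trans _ (le_trans s12 s2T))// gerBl.
  (* [phi 0] compares two evolutions of [u 0], and [phi s1] is [u t1 x1] minus the evolution of
     [u t1] up to [s2] at [x2]. Duhamel's formula gives the derivative in between. *)
  pose phi s := S s s1 (w s) x1 - S s s2 (w s) x2.
  have phiC : continuous phi by apply: continuous_sub; exact: SwC.
  have phiD (s : R) f : 0 < s -> (forall y, is_derive s 1 (fun r => w r y)
      (gen (@torus_step n N) N (b s) (w s) y + f y)) ->
      is_derive s 1 phi (S s s1 f x1 - S s s2 f x2).
    by move=> s0 wD; apply: is_derive_sub; exact: SwD.
  have piece (p q M : R) F : 0 <= p -> p <= q -> q <= s1 ->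
      (forall (s : R) y, p < s < q -> is_derive s 1 (fun r => w r y)
        (gen (@torus_step n N) N (b s) (w s) y + F s y)) ->
      (forall (s : R) y, p < s < q -> `|F s y| <= M) -> 0 <= M ->
      `|phi q - phi p| <= C1 * M * (D * Q) * (2 * W).
    move=> p0 pq qs FD FM M0.
    have := @derive_bound R phi
      (fun s => C1 * M * (D * Q) * - (2 * Num.sqrt (s1 - s)))
      (fun s => S s s1 (F s) x1 - S s s2 (F s) x2)
      (fun s => C1 * M * (D * Q) * (Num.sqrt (s1 - s))^-1) p q pq phiC _ _ _ _.
    have sC := continuous_mul (@cst_continuous _ _ (C1 * M * (D * Q)))
      (@sqrt_from_continuous s1).
    move=> /(_ sC) H1.
    apply: (@le_trans _ _ (C1 * M * (D * Q) * - (2 * Num.sqrt (s1 - q)) -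
      C1 * M * (D * Q) * - (2 * Num.sqrt (s1 - p)))).
      apply: H1 => s spq; have /andP[ps sq] := spq.
      - apply: phiD => [|y]; first exact: le_lt_trans ps.
        exact: FD.
      - have ss1 : s < s1 by exact: lt_le_trans qs.
        apply: is_derive_eq (is_derive_mul (is_derive_cst (C1 * M * (D * Q)) s 1)
          (is_derive_sqrt_from ss1)) _.
        by rewrite mul0r add0r.
      - apply: key => [|y]; last exact: FM.
        by rewrite (le_trans p0 (ltW ps)) (lt_le_trans sq).
    rewrite -mulrBr ler_wpM2l ?mulr_ge0//.
    have s1pW : Num.sqrt (s1 - p) <= W.
      by rewrite ler_wsqrtr// (le_trans _ (le_trans s12 s2T))// gerBl.
    rewrite opprK addrC lerBlDr ler_wpDr ?mulr_ge0 ?sqrtr_ge0//.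
    by rewrite ler_wpM2l.
  have wD_before (s : R) y : 0 < s < 1 -> is_derive s 1 (fun r => w r y)
      (gen (@torus_step n N) N (b s) (w s) y +
        - gen (@torus_step n N) N (b s) (u 0) y).
    by move=> s01; exact: ext_sol_derive_before.
  have wD_after (s : R) y : 1 < s < 1 + T -> is_derive s 1 (fun r => w r y)
      (gen (@torus_step n N) N (b s) (w s) y + g (s - 1) y).
    move=> s1T.
    exact: (@ext_sol_derive_after R n N cm T delta a u delta01 g u_sol s y s1T).
  have g_after (s : R) y : 1 < s < 1 + T -> `|g (s - 1) y| <= G.
    by move=> /andP[s_1 sT]; apply: gG; rewrite subr_ge0 lerBlDl !ltW.
  (* The elapsed time is [s1 >= 1], so the Nash bound carries no singular factor: this is the gain
     from the continuation. *)
  have phi_0 : `|phi 0| <= C1 * U * (D * Q).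
    rewrite /phi w_before ?ler01//.
    apply: (le_trans (key 0 U (u 0) _ uU)).
      by rewrite lexx (lt_le_trans _ s11).
    rewrite subr0 ler_piMr ?mulr_ge0// invf_le1.
      by rewrite -[leLHS]sqrtr1 ler_wsqrtr.
    by rewrite sqrtr_gt0 (lt_le_trans _ s11).
  have phi_const : `|phi (1 - delta) - phi 0| <= C1 * H * (D * Q) * (2 * W).
    apply: (piece 0 (1 - delta) H
      (fun s y => - gen (@torus_step n N) N (b s) (u 0) y)) => //.
    - by rewrite subr_ge0.
    - by rewrite (le_trans _ s11)// gerBl ltW.
    - move=> s y /andP[s0 sd]; apply: wD_before; rewrite s0 (lt_le_trans sd)//.
      by rewrite gerBl ltW.
    - move=> s y /andP[s0 sd]; rewrite normrN.
      have -> : b s = fun _ _ => cm by apply: ext_coef_before => //; exact: ltW.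
      exact: uH.
  (* Here the maximum principle suffices: each of the two propagated sources is at most [K]. *)
  have phi_layer : `|phi 1 - phi (1 - delta)| <= 2 * K * delta.
    have -> : 2 * K * delta = 2 * K * 1 - 2 * K * (1 - delta) by ring.
    apply: (@derive_bound R phi (fun s => 2 * K * s)
      (fun s => S s s1 (fun y => - gen (@torus_step n N) N (b s) (u 0) y) x1 -
         S s s2 (fun y => - gen (@torus_step n N) N (b s) (u 0) y) x2)
      (fun _ => 2 * K)) => //.
    - by rewrite gerBl ltW.
    - by move=> s; apply: cvgM; [exact: cvg_cst|exact: cvg_id].
    - move=> s /andP[sd s_1]; have s0 : 0 < s by rewrite (le_lt_trans _ sd)// subr_ge0.
      by apply: phiD => // y; apply: wD_before; rewrite s0.
    - move=> s _; apply: is_derive_eq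
        (is_derive_mul (is_derive_cst (2 * K) s 1) (is_derive_id s 1)) _.
      by rewrite mul0r add0r mulr1.
    - move=> s /andP[sd s_1]; have s0 : 0 <= s by rewrite (le_trans _ (ltW sd))// subr_ge0.
      have uK y : `|- gen (@torus_step n N) N (b s) (u 0) y| <= K.
        by rewrite normrN; exact: gen_bound cm0 (b_ell s) uU.
      rewrite (le_trans (ler_normB _ _))// mulr_natl mulr2n lerD//.
        by apply: SM => //; rewrite s0 (le_trans (ltW s_1)).
      by apply: SM => //; rewrite s0 (le_trans (ltW s_1))// (le_trans s11).
  have phi_after : `|phi s1 - phi 1| <= C1 * G * (D * Q) * (2 * W).
    apply: (piece 1 s1 G (fun s y => g (s - 1) y)) => //.
    - move=> s y /andP[s_1 ss1]; apply: wD_after.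
      by rewrite s_1 (lt_le_trans ss1)// (le_trans s12).
    - move=> s y /andP[s_1 ss1]; apply: g_after.
      by rewrite s_1 (lt_le_trans ss1)// (le_trans s12).
  have w1 : w s1 = u t1.
    by rewrite w_after /s1 ?[1 + _ - 1]addrAC ?subrr ?add0r// -/s1 s11 (le_trans s12).
  have w2 : w s2 = u t2.
    by rewrite w_after /s2 ?[1 + _ - 1]addrAC ?subrr ?add0r// -/s2 s2T (le_trans s11).
  have s10 : 0 <= s1 by exact: le_trans s11.
  have s20 : 0 <= s2 by exact: le_trans s12.
  (* Only the point [x2] is left on [s1, s2]; the maximum principle bounds the propagated source by
     [G]. *)
  have chi : `|S s2 s2 (w s2) x2 - S s1 s2 (w s1) x2| <= G * (t2 - t1).
    have -> : G * (t2 - t1) = G * s2 - G * s1 by rewrite /s1 /s2; ring.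
    apply: (@derive_bound R (fun s => S s s2 (w s) x2) (fun s => G * s)
      (fun s => S s s2 (g (s - 1)) x2) (fun _ => G)) => //.
    - exact: SwC.
    - by move=> s; apply: cvgM; [exact: cvg_cst|exact: cvg_id].
    - move=> s /andP[ss1 ss2]; have s_1 := le_lt_trans s11 ss1.
      apply: SwD => [|y]; first by rewrite (lt_trans _ s_1).
      by apply: wD_after; rewrite s_1 (lt_le_trans ss2).
    - move=> s _; apply: is_derive_eq
        (is_derive_mul (is_derive_cst G s 1) (is_derive_id s 1)) _.
      by rewrite mul0r add0r mulr1.
    - move=> s /andP[ss1 ss2]; have s_1 := le_lt_trans s11 ss1.
      apply: SM => [|y]; first by rewrite (le_trans s10 (ltW ss1)) ltW.
      by apply: g_after; rewrite s_1 (lt_le_trans ss2).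
  have phi_1 : phi s1 = u t1 x1 - S s1 s2 (w s1) x2 by rewrite /phi S1// w1.
  rewrite S1// w2 in chi.
  have -> : u t1 x1 - u t2 x2 = phi 0 + (phi (1 - delta) - phi 0)
      + (phi 1 - phi (1 - delta)) + (phi s1 - phi 1)
      - (u t2 x2 - S s1 s2 (w s1) x2) by rewrite phi_1; ring.
  rewrite (le_trans (ler_normB _ _))// lerD//.
  have n1 := ler_normD (phi 0) (phi (1 - delta) - phi 0).
  have n2 := ler_normD (phi 0 + (phi (1 - delta) - phi 0)) (phi 1 - phi (1 - delta)).
  have n3 := ler_normD (phi 0 + (phi (1 - delta) - phi 0) + (phi 1 - phi (1 - delta)))
    (phi s1 - phi 1).
  have -> : C1 * (G + H) * (D * Q) * (2 * W) =
    C1 * G * (D * Q) * (2 * W) + C1 * H * (D * Q) * (2 * W) by ring.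
  lra.
set E := r `^ sigma + d `^ sigma.
have E0 : 0 <= E by rewrite addr_ge0 ?powR_ge0.
apply: (@le_trans _ _ (C1 * U * (D * Q) + C1 * (G + H) * (D * Q) * (2 * W)
    + G * (t2 - t1))).
  (* Let [delta] = 2^-m tend to 0; the limit no longer contains [K]. *)
  apply: (@le_geometric _ _ _ (2 * K)) => m.
  have half01 : 0 < (2^-1 : R) <= 1 by rewrite invr_gt0 ltr0n invf_le1 ?ler1n.
  have /andP[half0 half1] := half01.
  have deltam : 0 < (2^-1 : R) ^+ m <= 1.
    by rewrite exprn_gt0//= exprn_ile1// ltW.
  apply: (le_trans (layer _ deltam)).
  by rewrite le_eqVlt; apply/orP; left; apply/eqP; ring.
have rW : r <= W by rewrite ler_wsqrtr//; lra.
(* Write t2 - t1 = r r, bound one factor by [W] and the other by r^sigma Q. *)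
have tE : t2 - t1 <= W * Q * E.
  rewrite -[leLHS]sqr_sqrtr ?subr_ge0// -/r expr2 -mulrA ler_pM//.
  have r0W : 0 <= r <= W by rewrite r0.
  apply: (le_trans (le_powR_interp sg1 r0W)).
  by rewrite mulrC ler_wpM2l// lerDl powR_ge0.
have GE : (C1 * Q) * (U * D) <= (C1 * Q) * ((G + U + H) * E).
  by rewrite ler_wpM2l ?mulr_ge0// ler_pM//; lra.
have HE : (2 * C1 * Q * W) * ((G + H) * D) <= (2 * C1 * Q * W) * ((G + U + H) * E).
  by rewrite ler_wpM2l ?mulr_ge0// ler_pM ?addr_ge0//; lra.
have TE : G * (t2 - t1) <= (G + U + H) * (W * Q * E).
  by rewrite ler_pM ?subr_ge0//; lra.
have -> : Q * (C1 + 2 * C1 * W + W) * (G + U + H) * E =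
  (C1 * Q) * ((G + U + H) * E) + (2 * C1 * Q * W) * ((G + U + H) * E)
  + (G + U + H) * (W * Q * E) by ring.
have -> : C1 * U * (D * Q) = (C1 * Q) * (U * D) by ring.
have -> : C1 * (G + H) * (D * Q) * (2 * W) = (2 * C1 * Q * W) * ((G + H) * D) by ring.
by rewrite !lerD.
Qed.

End HolderEstimate.

(** * Torus distance, second differences and the final constant *)

Section Assembly.
Context {R : realType}.

Lemma enormN (n : nat) (v : 'rV[R]_n) : enorm (- v) = enorm v.
Proof. by congr Num.sqrt; apply: eq_bigr => i _; rewrite mxE sqrrN. Qed.

(** Each bound is solved for [d k] by raising to the power 1/sigma; this gives a common lower bound
    of all [d k], hence of their infimum, attained or not. *)
Lemma le_powR_inf (K : Type) (k0 : K) (d : K -> R) (sigma x A B : R) :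
  0 < sigma -> 0 <= A -> (forall k, 0 <= d k) ->
  (forall k, x <= A * (B + d k `^ sigma)) ->
  x <= A * (B + inf [set d k | k in [set: K]] `^ sigma).
Proof.
move=> sg0 A0 d0 xd; set rho := inf _.
have sgV : sigma^-1 * sigma = 1 by rewrite mulVf ?gt_eqF.
move: A0; rewrite le_eqVlt => /predU1P[A0|A0].
  by have := xd k0; rewrite -A0 !mul0r.
have {}xd k : x / A - B <= d k `^ sigma.
  by rewrite lerBlDl ler_pdivrMr// mulrC.
suff : x / A - B <= rho `^ sigma by rewrite lerBlDl ler_pdivrMr// mulrC.
have [y0|y0] := leP (x / A - B) 0; first exact: le_trans (powR_ge0 _ _).
have yrho : (x / A - B) `^ sigma^-1 <= rho.
  apply: lb_le_inf => [|_ [k _ <-]]; first by exists (d k0); exists k0.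
  rewrite -[leRHS]powRr1// -(mulfV (lt0r_neq0 sg0)) powRrM.
  apply: ge0_ler_powR (xd k); rewrite ?nnegrE ?powR_ge0// ?invr_ge0; exact: ltW.
rewrite -[leLHS]powRr1 ?(ltW y0)// -sgV powRrM.
have rho0 := le_trans (powR_ge0 _ _) yrho.
by apply: ge0_ler_powR => //; rewrite ?nnegrE ?powR_ge0// ltW.
Qed.

(** For constant coefficients the increments along e and -e pair up into -N^-2 times the second
    difference along e and -e. Every pair is counted twice, whence the factor 1/2. *)
Lemma gen_cst_bound (n N : nat) (cm C0 : R) (v : torus n N -> R) x : 0 < cm ->
  (forall y e1 e2,
    `|grad (@torus_step n N) N e1 (grad (@torus_step n N) N e2 v) y| <= C0) ->
  `|gen (@torus_step n N) N (fun _ _ => cm) v x| <= cm / 2 * #|dir n|%:R * C0.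
Proof.
move=> cm0 vC0.
have oppK : involutive (@dir_opp n) by case=> i b; rewrite /dir_opp negbK.
pose f e := v (x + torus_step N e) - v x.
have fsum : 2 * \sum_e f e = \sum_e (f e + f (dir_opp e)).
  have fopp : \sum_e f (dir_opp e) = \sum_e f e.
    by rewrite [RHS](reindex_inj (inv_inj oppK)).
  by rewrite mulr_natl mulr2n -{2}fopp -big_split.
have -> : gen (@torus_step n N) N (fun _ _ => cm) v x =
    - (cm / 2) * \sum_e grad (@torus_step n N) N e
      (grad (@torus_step n N) N (dir_opp e) v) x.
  rewrite /gen -mulr_sumr -/f.
  have -> : \sum_e grad (@torus_step n N) N e
      (grad (@torus_step n N) N (dir_opp e) v) x =
      - N%:R ^+ 2 * \sum_e (f e + f (dir_opp e)).
    rewrite mulr_sumr; apply: eq_bigr => e _.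
    by rewrite /grad /f torus_step_opp addrK; ring.
  rewrite -fsum; by field.
have cm2 : 0 <= cm / 2 by rewrite divr_ge0// ltW.
rewrite normrM normrN (ger0_norm cm2).
rewrite -mulrA ler_wpM2l//.
apply: (le_trans (ler_norm_sum _ _ _)).
apply: (@le_trans _ _ (\sum_(e : dir n) C0)); first by apply: ler_sum => e _.
by rewrite sumr_const mulr_natl.
Qed.

(** Boundedness matters, since [sup] takes a default value on unbounded sets. *)
Lemma le_sup_norm (S : Type) (D : set S) (f : S -> R) z :
  [bounded f y | y in D] -> D z -> `|f z| <= sup_norm D f.
Proof.
move=> [M [_ /(_ (M + 1))]]; rewrite ltrDl ltr01 => /(_ isT) fM Dz.
by apply: ub_le_sup; [exists (M + 1) => _ [y Dy <-]; exact: fM|exists z].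
Qed.

End Assembly.

Theorem theorem2p5 (R : realType) (n : nat) (cm cp sigma T : R)
    (hn : (0 < n)%N) (hcm : 0 < cm) (hcp : cm < cp)
    (hsigma : nash_exponent n cm cp sigma) (hT : 0 < T) :
  exists C : R,
    forall (a : forall N : nat, R -> torus n N -> dir n -> R)
           (g u : forall N : nat, R -> torus n N -> R) (C0 : R),
    (forall N, (0 < N)%N ->
      [/\ forall t, 0 <= t <= T -> elliptic (@torus_step n N) cm cp (a N t),
          forall x e, {within `[0, T], continuous (fun t => a N t x e)},
          [bounded g N z.1 z.2 | z in `[0, T] `*` [set: torus n N]],
          forall x, {within `[0, T], continuous (fun t => g N t x)}
        & is_solution (@torus_step n N) N `[0, T] (a N) (g N) (u N)]) ->
    (forall N, (0 < N)%N -> forall x e1 e2,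
      `|grad (@torus_step n N) N e1 (grad (@torus_step n N) N e2 (u N 0)) x|
        <= C0) ->
    forall N, (0 < N)%N -> forall (t1 t2 : R) (x1 x2 : torus n N),
      0 <= t1 <= T -> 0 <= t2 <= T ->
      `|u N t1 x1 - u N t2 x2| <=
        C * (sup_norm (`[0, T] `*` [set: torus n N]) (fun z => g N z.1 z.2)
             + sup_norm setT (u N 0) + C0)
          * (`|t2 - t1| `^ (sigma / 2) + torus_dist R x1 x2 `^ sigma).
Proof.
have [/andP[sg0 sg1] _] := hsigma.
have [C' C'0 est] := holder_estimate hcm (ltW hcp) hsigma hT.
pose c : R := cm / 2 * #|dir n|%:R.
have c0 : 0 <= c by rewrite !mulr_ge0// ltW.
(* [c * C0] plays the role of [H], and G + U + c C0 <= (1 + c) (G + U + C0). *)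
exists (C' * (1 + c)) => a g u C0 sol u0C0 N N0 t1 t2 x1 x2 t1T t2T.
have [a_ell aC gbnd _ u_sol] := sol N N0.
set G := sup_norm (_ `*` _) _; set U := sup_norm setT _.
have gG t x : 0 <= t <= T -> `|g N t x| <= G.
  by move=> tT; apply: (le_sup_norm (z := (t, x)) gbnd); split; rewrite //= in_itv.
have ubnd : [bounded u N 0 x | x in [set: torus n N]].
  exists (\sum_(x : 'rV['I_N.-1.+1]_n) `|u N 0 x|); split; first exact: num_real.
  move=> B uB x _; apply: le_trans (ltW uB).
  by rewrite (bigD1 (x : 'rV['I_N.-1.+1]_n))//= lerDl sumr_ge0.
have uU x : `|u N 0 x| <= U by exact: (le_sup_norm (z := x) ubnd).
have uH x := gen_cst_bound x hcm (u0C0 N N0).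
(* A direction exists because [n] is positive, so [C0] bounds at least one absolute value. *)
have C00 : 0 <= C0.
  by apply: le_trans (u0C0 N N0 0 (Ordinal hn, false) (Ordinal hn, false)).
have G0 : 0 <= G by apply: le_trans (gG 0 0 _) => //; rewrite lexx ltW.
have U0 : 0 <= U by apply: le_trans (uU 0).
have estk k : `|u N t1 x1 - u N t2 x2| <= C' * (1 + c) * (G + U + C0) *
    (`|t2 - t1| `^ (sigma / 2) +
     enorm (torus_pos R x1 - torus_pos R x2 + map_mx intr k) `^ sigma).
  have sqrtE (s : R) : 0 <= s -> Num.sqrt s `^ sigma = `|s| `^ (sigma / 2).
    by move=> s0; rewrite -powR12_sqrt// -powRrM mulrC ger0_norm.
  apply: (@le_trans _ _ (C' * (G + U + c * C0) *
    (`|t2 - t1| `^ (sigma / 2) +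
     enorm (torus_pos R x1 - torus_pos R x2 + map_mx intr k) `^ sigma))).
    have /andP[t10 t1T'] := t1T; have /andP[t20 t2T'] := t2T.
    have [t12|/ltW t21] := leP t1 t2.
      rewrite -sqrtE ?subr_ge0//.
      exact: (est N (a N) (g N) (u N) G U (c * C0)).
    (* When [t2 <= t1] the two points are exchanged, which turns the translation [k] into [- k]. *)
    rewrite distrC (distrC t2) -sqrtE ?subr_ge0//.
    have -> : enorm (torus_pos R x1 - torus_pos R x2 + map_mx intr k) =
        enorm (torus_pos R x2 - torus_pos R x1 + map_mx intr (- k)).
      by rewrite -enormN; congr enorm; apply/rowP => i; rewrite !mxE rmorphN; ring.
    exact: (est N (a N) (g N) (u N) G U (c * C0)).
  rewrite ler_wpM2r ?addr_ge0 ?powR_ge0// -mulrA ler_wpM2l//.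
  rewrite mulrDl mul1r lerD ?lerDl// ler_wpM2l// lerDr.
  exact: addr_ge0.
apply: (le_powR_inf (0 : 'rV[int]_n)) => //.
- by rewrite !mulr_ge0// !addr_ge0.
- by move=> k; exact: enorm_ge0.
Qed.
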